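(* Let $0\le n\le l$. Under the isomorphism $S_n^l\cong\mathrm{END}_{W_n^l}(Q)=\bigoplus_{\mu,\nu\in\mathcal{P}_n^l}\varepsilon(\mu)W_n^l\varepsilon(\nu)\subset W_n^l$, the cellular basis $\bigsqcup_{\lambda\in\mathcal{P}_n^l}\{D^\lambda_{\mathfrak s\mathfrak t}\mid \mathfrak s,\mathfrak t\in \mathrm T_\lambda\}$ of $S_n^l$ is identified with the part of the cellular basis $\bigsqcup_{\lambda}\{B^\lambda_{\mathfrak s\mathfrak t}\}$ of $W_n^l$ in which tableaux are only allowed to be filled by the letters $\{1_i\mid i=1,\dots,l\}$, that is, with $\bigsqcup_{\lambda\in\mathcal{P}_n^l}\{B^\lambda_{\mathfrak s\mathfrak t}\mid \mathfrak s,\mathfrak t\in \mathrm T''_\lambda\}$.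
   Context: **Webster algebra.** $\Bbbk$ is a field of characteristic $p>0$. $W_n^l$ has $l$ red and $n$ black strands. For sequences $\kappa\in\{r,b\}^{l+n}$ with $l$ letters $r$, $n$ letters $b$ there are orthogonal idempotents $\varepsilon(\kappa)$ summing to $1$; dots $x_k\varepsilon(\kappa)$ for $\kappa_k=b$ (degree 2); crossings $\sigma_k\varepsilon(\kappa)=\varepsilon(s_k\kappa)\sigma_k$ of strands $k,k+1$ unless both are red (degree $-2$ for $bb$, $1$ for $rb$, $br$). Product $ab$ means $a$ on top of $b$. Far away generators commute. With the indicated letters of $\kappa$ (bottom) at positions $k,k+1(,k+2)$: ($bb$) $\sigma_k^2=0$, $\sigma_kx_k-x_{k+1}\sigma_k=1=x_k\sigma_k-\sigma_kx_{k+1}$; ($bbb,bbr,rbb$) $\sigma_k\sigma_{k+1}\sigma_k=\sigma_{k+1}\sigma_k\sigma_{k+1}$; ($brb$) $\sigma_k\sigma_{k+1}\sigma_k-\sigma_{k+1}\sigma_k\sigma_{k+1}=1$; ($rb$) $\sigma_k^2=x_{k+1}$, $\sigma_kx_{k+1}=x_k\sigma_k$; ($br$) $\sigma_k^2=x_k$, $\sigma_kx_k=x_{k+1}\sigma_k$ (each times $\varepsilon(\kappa)$); $\varepsilon(\kappa)=0$ if $\kappa_1=b$. The anti-involution $*$ flips diagrams upside down. **Partitions.** $\mathcal{P}_n^l=\{\lambda\in\{0,1\}^l:\sum\lambda^i=n\}$; entries $1$ are boxes, $0$ empty slots; $j_1(\lambda)<\dots<j_n(\lambda)$ are the box positions.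 $\kappa_\lambda$ is read left to right: a red strand followed by a black strand for each box, just a red strand for each empty slot; $\varepsilon(\lambda)=\varepsilon(\kappa_\lambda)$, $Q(\lambda)=\varepsilon(\lambda)W_n^l$, $Q=\bigoplus_\lambda Q(\lambda)$. **Quiver Schur algebra.** $\mathrm{NH}_n^l$ is generated by $y_1,\dots,y_n,\psi_1,\dots,\psi_{n-1}$ with $y_iy_j=y_jy_i$, $y_i\psi_j=\psi_jy_i$ ($i\neq j,j+1$), $y_i\psi_i-\psi_iy_{i+1}=1=\psi_iy_i-y_{i+1}\psi_i$, $\psi_i^2=0$, $\psi_i\psi_j=\psi_j\psi_i$ ($|i-j|>1$), $\psi_i\psi_{i+1}\psi_i=\psi_{i+1}\psi_i\psi_{i+1}$, $y_1^l=0$ (degrees $2,-2$). $G(\lambda)$ is the right ideal $y_1^{l-j_1(\lambda)}\cdots y_n^{l-j_n(\lambda)}\mathrm{NH}_n^l$ with grading shifted by $-nl+\sum j_k(\lambda)$, and $S_n^l=\mathrm{END}_{\mathrm{NH}_n^l}(\bigoplus_\lambda G(\lambda))$ (graded endomorphisms). The isomorphism $\mathrm{END}_{W_n^l}(Q)\cong S_n^l$: let $\kappa_0$ be the sequence with all reds left of all blacks, $\varepsilon(\kappa_0)W_n^l\varepsilon(\kappa_0)\cong\mathrm{NH}_n^l$ ($x_{l+i}\leftrightarrow y_i$, $\sigma_{l+i}\leftrightarrow\psi_i$); left multiplication by the minimal dotless diagram $\theta_{\kappa_\lambda}\in\varepsilon(\kappa_0)W_n^l\varepsilon(\lambda)$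 identifies $\varepsilon(\lambda)W_n^l\varepsilon(\kappa_0)$ with $G(\lambda)$, and $f\in\mathrm{END}_{W_n^l}(Q)$ acts on $\mathrm{HOM}_{W_n^l}(\varepsilon(\kappa_0)W_n^l,Q)\cong\bigoplus_\lambda G(\lambda)$ by composition. **Elements $D$.** A $\mu$-tableau is a bijective filling of the boxes of $\mu$ by $1,\dots,n$. $\mathrm{Tab}_\lambda(\mu)$ is the set of $\mu$-tableaux $\mathfrak t$ such that for each $k$ the box of $\mu$ filled with $k$ lies weakly to the right of position $j_k(\lambda)$; $\mathrm T_\lambda=\bigsqcup_{\mu}\mathrm{Tab}_\lambda(\mu)$. For $\mathfrak t\in\mathrm{Tab}_\lambda(\mu)$, $D^{\mathfrak t}_\lambda\in\varepsilon(\mu)W_n^l\varepsilon(\lambda)$ is the dotless diagram with bottom $\kappa_\lambda$, top $\kappa_\mu$, in which the $k$th black bottom point is joined to the black top point of the box of $\mu$ filled with $k$ (reduced black diagram), and the $i$th red bottom point to the $i$th red top point, in a minimal way without triple intersections. $D^\lambda_{\mathfrak s\mathfrak t}=D^{\mathfrak s}_\lambda(D^{\mathfrak t}_\lambda)^*$. Under the isomorphism above these elements form the Hu–Mathas cellular basis of $S_n^l$. **Elements $B$ (Stroppel–Webster).** Take alphabets $1_i,2_i,\dots$ for $i=1,\dots,l$. A multi-standard tableau of shape $\lambda$ is a filling of the boxes of $\lambda$ by distinct letters such that (1) letters of the $i$th alphabet appear only in the first $i$ parts of $\lambda$; (2) if $a_i$ occurs then so do $1_i,\dots,(a-1)_i$.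 $\mathrm T'_\lambda$ is the set of these, and $\mathrm T''_\lambda\subset\mathrm T'_\lambda$ the subset using only letters $1_1,\dots,1_l$. The entry sequence of $\mathfrak t\in\mathrm T'_\lambda$ is: for $i=1,\dots,l$ in order, the red dot number $i$ followed by black dots labeled by the positions of the boxes containing $1_i,2_i,\dots$ in this order. The shape sequence is $\kappa_\lambda$, with each black dot labeled by the position of its box and red dots numbered from the left. $B^{\mathfrak t}_\lambda$ is the dotless diagram with the entry sequence on top and the shape sequence at the bottom, joining dots with equal labels in a minimal way; $B^\lambda_{\mathfrak t}=(B^{\mathfrak t}_\lambda)^*$, $B^\lambda_{\mathfrak s\mathfrak t}=B^{\mathfrak s}_\lambda B^\lambda_{\mathfrak t}$. The $B^\lambda_{\mathfrak s\mathfrak t}$ ($\mathfrak s,\mathfrak t\in\mathrm T'_\lambda$) form a cellular basis of $W_n^l$. *)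

(* Defs.v *)
From HB Require Import structures.
From mathcomp Require Import all_boot all_order perm all_algebra.
From mathcomp Require Import all_classical.

Set Implicit Arguments.
Unset Strict Implicit.
Unset Printing Implicit Defensive.

Import Order.TTheory GRing.Theory Num.Theory.

Local Open Scope quotient_scope.
Local Open Scope classical_set_scope.
Local Open Scope ring_scope.

Section Presentation.
Variables (k : fieldType) (X : Type).

Inductive term : Type :=
| Gen of X
| Zero
| One
| Add of term & term
| Opp of term
| Mul of term & term
| Scale of k & term.

HB.instance Definition _ := gen_eqMixin term.
HB.instance Definition _ := gen_choiceMixin term.

Variable R : term -> term -> Prop.

(* The least congruence containing [R] whose quotient is a unital associative
   [k]-algebra. *)
Inductive cong : term -> term -> Prop :=
| cong_rel a b : R a b -> cong a b
| cong_refl a : cong a a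
| cong_sym a b : cong a b -> cong b a
| cong_trans a b c : cong a b -> cong b c -> cong a c
| cong_add a a' b b' : cong a a' -> cong b b' -> cong (Add a b) (Add a' b')
| cong_opp a a' : cong a a' -> cong (Opp a) (Opp a')
| cong_mul a a' b b' : cong a a' -> cong b b' -> cong (Mul a b) (Mul a' b')
| cong_scale x a a' : cong a a' -> cong (Scale x a) (Scale x a')
| cong_addA a b c : cong (Add a (Add b c)) (Add (Add a b) c)
| cong_addC a b : cong (Add a b) (Add b a)
| cong_add0 a : cong (Add Zero a) a
| cong_addN a : cong (Add (Opp a) a) Zero
| cong_mulA a b c : cong (Mul a (Mul b c)) (Mul (Mul a b) c)
| cong_mul1l a : cong (Mul One a) a
| cong_mul1r a : cong (Mul a One) a
| cong_mulDl a b c : cong (Mul (Add a b) c) (Add (Mul a c) (Mul b c))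
| cong_mulDr a b c : cong (Mul a (Add b c)) (Add (Mul a b) (Mul a c))
| cong_scaleA x y a : cong (Scale x (Scale y a)) (Scale (x * y) a)
| cong_scale1 a : cong (Scale 1 a) a
| cong_scaleDr x a b : cong (Scale x (Add a b)) (Add (Scale x a) (Scale x b))
| cong_scaleDl x y a : cong (Scale (x + y) a) (Add (Scale x a) (Scale y a))
| cong_scaleAl x a b : cong (Scale x (Mul a b)) (Mul (Scale x a) b)
| cong_scaleAr x a b : cong (Scale x (Mul a b)) (Mul a (Scale x b)).

Definition congb (a b : term) : bool := `[< cong a b >].

Lemma congb_equiv : equiv_class_of congb.
Proof.
split.
- by move=> a; apply/asboolP; apply: cong_refl.
- by move=> a b; apply/asboolP/asboolP; apply: cong_sym.
- move=> b a c /asboolP ab /asboolP bc; apply/asboolP.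
  exact: cong_trans ab bc.
Qed.

Canonical congb_equivRel := EquivRelPack congb_equiv.

Definition presented : Type := {eq_quot congb_equivRel}.

HB.instance Definition _ := Choice.on presented.

Definition pcls (a : term) : presented := \pi_{eq_quot congb_equivRel} a.

Lemma pclsP a b : pcls a = pcls b <-> cong a b.
Proof.
split=> [/eqmodP /asboolP //|ab]; apply/eqmodP; exact/asboolP.
Qed.

Lemma pcls_ind (P : presented -> Prop) :
  (forall a, P (pcls a)) -> forall u, P u.
Proof. by move=> Pa; elim/quotW => a; apply: Pa. Qed.

Definition prep (u : presented) : term := repr (u : {eq_quot congb_equivRel}).

Lemma prepK u : pcls (prep u) = u.
Proof. exact: reprK. Qed.

Lemma prep_cong a : cong (prep (pcls a)) a.
Proof. by apply/pclsP; rewrite prepK. Qed.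

Definition padd (u v : presented) := pcls (Add (prep u) (prep v)).
Definition popp (u : presented) := pcls (Opp (prep u)).
Definition pmul (u v : presented) := pcls (Mul (prep u) (prep v)).
Definition pscale (x : k) (u : presented) := pcls (Scale x (prep u)).

Lemma pcls_add a b : padd (pcls a) (pcls b) = pcls (Add a b).
Proof. by apply/pclsP; apply: cong_add; apply: prep_cong. Qed.
Lemma pcls_opp a : popp (pcls a) = pcls (Opp a).
Proof. by apply/pclsP; apply: cong_opp; apply: prep_cong. Qed.
Lemma pcls_mul a b : pmul (pcls a) (pcls b) = pcls (Mul a b).
Proof. by apply/pclsP; apply: cong_mul; apply: prep_cong. Qed.
Lemma pcls_scale x a : pscale x (pcls a) = pcls (Scale x a).
Proof. by apply/pclsP; apply: cong_scale; apply: prep_cong. Qed.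

Lemma paddA : associative padd.
Proof.
elim/pcls_ind=> a; elim/pcls_ind=> b; elim/pcls_ind=> c.
by rewrite !pcls_add; apply/pclsP; apply: cong_addA.
Qed.
Lemma paddC : commutative padd.
Proof.
elim/pcls_ind=> a; elim/pcls_ind=> b.
by rewrite !pcls_add; apply/pclsP; apply: cong_addC.
Qed.
Lemma padd0 : left_id (pcls Zero) padd.
Proof. by elim/pcls_ind=> a; rewrite pcls_add; apply/pclsP/cong_add0. Qed.
Lemma paddN : left_inverse (pcls Zero) popp padd.
Proof.
by elim/pcls_ind=> a; rewrite pcls_opp pcls_add; apply/pclsP/cong_addN.
Qed.

HB.instance Definition _ := GRing.isZmodule.Build presented
  paddA paddC padd0 paddN.

Lemma pmulA : associative pmul.
Proof.
elim/pcls_ind=> a; elim/pcls_ind=> b; elim/pcls_ind=> c.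
by rewrite !pcls_mul; apply/pclsP; apply: cong_mulA.
Qed.
Lemma pmul1l : left_id (pcls One) pmul.
Proof. by elim/pcls_ind=> a; rewrite pcls_mul; apply/pclsP/cong_mul1l. Qed.
Lemma pmul1r : right_id (pcls One) pmul.
Proof. by elim/pcls_ind=> a; rewrite pcls_mul; apply/pclsP/cong_mul1r. Qed.
Lemma pmulDl : left_distributive pmul +%R.
Proof.
elim/pcls_ind=> a; elim/pcls_ind=> b; elim/pcls_ind=> c.
rewrite /GRing.add /= pcls_add !pcls_mul pcls_add.
by apply/pclsP; apply: cong_mulDl.
Qed.
Lemma pmulDr : right_distributive pmul +%R.
Proof.
elim/pcls_ind=> a; elim/pcls_ind=> b; elim/pcls_ind=> c.
rewrite /GRing.add /= pcls_add !pcls_mul pcls_add.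
by apply/pclsP; apply: cong_mulDr.
Qed.

(* Possibly trivial rings: for some presentations [1 = 0]. *)
HB.instance Definition _ := GRing.Zmodule_isPzRing.Build presented
  pmulA pmul1l pmul1r pmulDl pmulDr.

Lemma pscaleA x y u : pscale x (pscale y u) = pscale (x * y) u.
Proof.
elim/pcls_ind: u => a; rewrite !pcls_scale.
by apply/pclsP; apply: cong_scaleA.
Qed.
Lemma pscale1 : left_id 1 pscale.
Proof. by elim/pcls_ind=> a; rewrite pcls_scale; apply/pclsP/cong_scale1. Qed.
Lemma pscaleDr : right_distributive pscale +%R.
Proof.
move=> x; elim/pcls_ind=> a; elim/pcls_ind=> b.
rewrite /GRing.add /= pcls_add !pcls_scale pcls_add.
by apply/pclsP; apply: cong_scaleDr.
Qed.
Lemma pscaleDl u : {morph pscale^~ u : x y / x + y}.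
Proof.
move=> x y; elim/pcls_ind: u => a.
rewrite /= {2}/GRing.add /= !pcls_scale pcls_add.
by apply/pclsP; apply: cong_scaleDl.
Qed.

HB.instance Definition _ := GRing.Zmodule_isLmodule.Build k presented
  pscaleA pscale1 pscaleDr pscaleDl.

Lemma pclsD a b : pcls (Add a b) = pcls a + pcls b.
Proof. by rewrite -pcls_add. Qed.
Lemma pclsN a : pcls (Opp a) = - pcls a.
Proof. by rewrite -pcls_opp. Qed.
Lemma pclsM a b : pcls (Mul a b) = pcls a * pcls b.
Proof. by rewrite -pcls_mul. Qed.
Lemma pclsZ x a : pcls (Scale x a) = x *: pcls a.
Proof. by rewrite -pcls_scale. Qed.
Lemma pcls0 : pcls Zero = 0. Proof. by []. Qed.
Lemma pcls1 : pcls One = 1. Proof. by []. Qed.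

(* The library's algebra structures require [1 != 0], hence bare lemmas. *)
Lemma presented_scaleAl (x : k) (u v : presented) :
  x *: (u * v) = (x *: u) * v.
Proof.
elim/pcls_ind: u => a; elim/pcls_ind: v => b.
rewrite -!(pclsM, pclsZ).
by apply/pclsP; apply: cong_scaleAl.
Qed.
Lemma presented_scaleAr (x : k) (u v : presented) :
  x *: (u * v) = u * (x *: v).
Proof.
elim/pcls_ind: u => a; elim/pcls_ind: v => b.
rewrite -!(pclsM, pclsZ).
by apply/pclsP; apply: cong_scaleAr.
Qed.

Definition pgen (x : X) : presented := pcls (Gen x).

(* Reversal of products, fixing the generators. *)
Fixpoint flip (a : term) : term :=
  match a with
  | Gen x => Gen x
  | Zero => Zero
  | One => One
  | Add b c => Add (flip b) (flip c)
  | Opp b => Opp (flip b)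
  | Mul b c => Mul (flip c) (flip b)
  | Scale x b => Scale x (flip b)
  end.

Lemma flip_cong :
  (forall a b, R a b -> cong (flip a) (flip b)) ->
  forall a b, cong a b -> cong (flip a) (flip b).
Proof.
move=> RP a b; elim=> {a b} /= *;
  by [exact: RP | exact: cong_refl | exact: cong_sym | exact: cong_add
    | exact: cong_opp | exact: cong_mul | exact: cong_scale
    | exact: cong_addA | exact: cong_addC | exact: cong_add0
    | exact: cong_addN | apply: cong_sym; exact: cong_mulA
    | exact: cong_mul1l | exact: cong_mul1r | exact: cong_mulDl
    | exact: cong_mulDr | exact: cong_scaleA | exact: cong_scale1
    | exact: cong_scaleDr | exact: cong_scaleDl | exact: cong_scaleAl
    | exact: cong_scaleAr | apply: cong_trans; eassumption].
Qed.

Definition pflip (u : presented) : presented := pcls (flip (prep u)).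

End Presentation.

Arguments Zero {k X}.
Arguments One {k X}.
Arguments Gen {k X} _.

Declare Scope term_scope.
Delimit Scope term_scope with T.
Notation "0" := Zero : term_scope.
Notation "1" := One : term_scope.
Notation "a + b" := (Add a b) : term_scope.
Notation "a - b" := (Add a (Opp b)) : term_scope.
Notation "a * b" := (Mul a b) : term_scope.
Notation "a ^+ m" := (iter m (Mul a) One) : term_scope.

(* Positions are numbered from 0.  A crossing [i : 'I_m.-1] involves the
   positions [lo i] and [hi i = lo i + 1]. *)

Lemma lo_proof m (i : 'I_m.-1) : (i < m)%N.
Proof. by case: m i => [|m] [i /= Hi] //; apply: ltnW. Qed.
Lemma hi_proof m (i : 'I_m.-1) : (i.+1 < m)%N.
Proof. by case: m i => [|m] [i /= Hi]. Qed.
Definition lo m (i : 'I_m.-1) : 'I_m := Ordinal (lo_proof i).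
Definition hi m (i : 'I_m.-1) : 'I_m := Ordinal (hi_proof i).

(* The simple transposition exchanging the positions [lo i] and [hi i]. *)
Definition simple m (i : 'I_m.-1) : 'S_m := tperm (lo i) (hi i).

Section NilHecke.
Variables (k : fieldType) (l n : nat).

Inductive nh_gen : Type := NHy of 'I_n | NHpsi of 'I_n.-1.

Definition nh_gen_deg (g : nh_gen) : int :=
  match g with NHy _ => 2%:Z | NHpsi _ => - 2%:Z end.

Local Notation y i := (Gen (NHy i)).
Local Notation psi i := (Gen (NHpsi i)).

Inductive nh_rel : term k nh_gen -> term k nh_gen -> Prop :=
| nh_yy i j : nh_rel (y i * y j)%T (y j * y i)%T
| nh_ypsi i j : i != lo j -> i != hi j -> nh_rel (y i * psi j)%T (psi j * y i)%T
| nh_dot_l i : nh_rel (y (lo i) * psi i - psi i * y (hi i))%T 1%T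
| nh_dot_r i : nh_rel (psi i * y (lo i) - y (hi i) * psi i)%T 1%T
| nh_sq i : nh_rel (psi i * psi i)%T 0%T
| nh_far (i j : 'I_n.-1) : (i.+1 < j)%N -> nh_rel (psi i * psi j)%T (psi j * psi i)%T
| nh_braid (i j : 'I_n.-1) : j = i.+1 :> nat ->
    nh_rel (psi i * psi j * psi i)%T (psi j * psi i * psi j)%T
| nh_cyc (i : 'I_n) : i = 0%N :> nat -> nh_rel (y i ^+ l)%T 0%T.

Definition NH : Type := presented nh_rel.
HB.instance Definition _ := GRing.PzRing.on NH.
HB.instance Definition _ := GRing.Lmodule.on NH.

Definition nhgen (g : nh_gen) : NH := pgen nh_rel g.
Definition nh_y (i : 'I_n) : NH := nhgen (NHy i).
Definition nh_psi (i : 'I_n.-1) : NH := nhgen (NHpsi i).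

Definition nh_homogeneous (d : int) : set NH :=
  [set v | exists (N : nat) (c : 'I_N -> k) (m : 'I_N -> seq nh_gen),
     (forall i, \sum_(g <- m i) nh_gen_deg g = d) /\
     v = \sum_(i < N) c i *: \prod_(g <- m i) nhgen g].

End NilHecke.

Section Webster.
Variables (k : fieldType) (l n : nat).

(* Sequences of letters are boolean tuples: [true] is black, [false] is red. *)
Definition colouring := {kap : (l + n).-tuple bool | count id kap == n}.
HB.instance Definition _ := SubFinite.on colouring.

Definition black (kap : colouring) (i : 'I_(l + n)) : bool := tnth (val kap) i.

Lemma swap_proof (i : 'I_(l + n).-1) (kap : colouring) :
  count id [tuple black kap (simple i j) | j < l + n] == n.
Proof.
have countE (t : (l + n).-tuple bool) :
    count id t = (\sum_(j < l + n) (tnth t j : nat))%N.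
  by rewrite -sum1_count big_mkcond big_tuple; apply: eq_bigr => j _; case: (tnth t j).
apply/eqP; rewrite countE -[RHS](eqP (valP kap)) [RHS]countE.
rewrite [RHS](reindex_inj (@perm_inj _ (simple i))).
by apply: eq_bigr => j _; rewrite tnth_mktuple.
Qed.

Definition swap (i : 'I_(l + n).-1) (kap : colouring) : colouring :=
  @exist _ (fun t : (l + n).-tuple bool => count id t == n) _ (swap_proof i kap).

Inductive web_gen : Type :=
  Weps of colouring | Wx of 'I_(l + n) | Wsig of 'I_(l + n).-1.

Local Notation e kap := (Gen (Weps kap)).
Local Notation x i := (Gen (Wx i)).
Local Notation sg i := (Gen (Wsig i)).

(* [x i] and [sg i] stand for the sums over all [kap] of the dots
   x_i eps(kap) and crossings sigma_i eps(kap), the terms that do not exist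
   (dot on a red strand, crossing of two red strands) being 0. *)
Inductive web_rel : term k web_gen -> term k web_gen -> Prop :=
| web_orth kap kap' :
    web_rel (e kap * e kap')%T (if kap == kap' then e kap else 0%T)
| web_one : web_rel (\big[@Add _ _/0%T]_(kap : colouring) e kap) 1%T
| web_xe i kap : web_rel (x i * e kap)%T (e kap * x i)%T
| web_se i kap : web_rel (sg i * e kap)%T (e (swap i kap) * sg i)%T
| web_x_red i kap : ~~ black kap i -> web_rel (x i * e kap)%T 0%T
| web_s_red i kap : ~~ black kap (lo i) -> ~~ black kap (hi i) ->
    web_rel (sg i * e kap)%T 0%T
| web_xx i j : web_rel (x i * x j)%T (x j * x i)%T
| web_xs i j : i != lo j -> i != hi j -> web_rel (x i * sg j)%T (sg j * x i)%T
| web_ss (i j : 'I_(l + n).-1) : (i.+1 < j)%N ->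
    web_rel (sg i * sg j)%T (sg j * sg i)%T
| web_bb_sq i kap : black kap (lo i) -> black kap (hi i) ->
    web_rel (sg i * sg i * e kap)%T 0%T
| web_bb_r i kap : black kap (lo i) -> black kap (hi i) ->
    web_rel ((sg i * x (lo i) - x (hi i) * sg i) * e kap)%T (e kap)
| web_bb_l i kap : black kap (lo i) -> black kap (hi i) ->
    web_rel ((x (lo i) * sg i - sg i * x (hi i)) * e kap)%T (e kap)
| web_braid (i j : 'I_(l + n).-1) kap : j = i.+1 :> nat ->
    (black kap (lo i), black kap (hi i), black kap (hi j)) \in
      [:: (true, true, true); (true, true, false); (false, true, true)] ->
    web_rel (sg i * sg j * sg i * e kap)%T (sg j * sg i * sg j * e kap)%T
| web_brb (i j : 'I_(l + n).-1) kap : j = i.+1 :> nat ->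
    black kap (lo i) -> ~~ black kap (hi i) -> black kap (hi j) ->
    web_rel ((sg i * sg j * sg i - sg j * sg i * sg j) * e kap)%T (e kap)
| web_rb_sq i kap : ~~ black kap (lo i) -> black kap (hi i) ->
    web_rel (sg i * sg i * e kap)%T (x (hi i) * e kap)%T
| web_rb_x i kap : ~~ black kap (lo i) -> black kap (hi i) ->
    web_rel (sg i * x (hi i) * e kap)%T (x (lo i) * sg i * e kap)%T
| web_br_sq i kap : black kap (lo i) -> ~~ black kap (hi i) ->
    web_rel (sg i * sg i * e kap)%T (x (lo i) * e kap)%T
| web_br_x i kap : black kap (lo i) -> ~~ black kap (hi i) ->
    web_rel (sg i * x (lo i) * e kap)%T (x (hi i) * sg i * e kap)%T
| web_cyc (i : 'I_(l + n)) kap : i = 0%N :> nat -> black kap i ->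
    web_rel (e kap) 0%T.

Definition web : Type := presented web_rel.
HB.instance Definition _ := GRing.PzRing.on web.
HB.instance Definition _ := GRing.Lmodule.on web.

Definition eps (kap : colouring) : web := pgen web_rel (Weps kap).
Definition dot (i : 'I_(l + n)) : web := pgen web_rel (Wx i).
Definition sigma (i : 'I_(l + n).-1) : web := pgen web_rel (Wsig i).

(* The anti-involution flipping diagrams upside down; it is well defined by
   [web_flip] below. *)
Definition star : web -> web := @pflip _ _ web_rel.

Local Notation cls := (pcls web_rel).
Let rel_eq a b : web_rel a b -> cls a = cls b.
Proof. by move=> ab; apply/pclsP/cong_rel. Qed.

Lemma swap_lo i kap : black (swap i kap) (lo i) = black kap (hi i).
Proof. by rewrite /black tnth_mktuple /simple tpermL. Qed.
Lemma swap_hi i kap : black (swap i kap) (hi i) = black kap (lo i).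
Proof. by rewrite /black tnth_mktuple /simple tpermR. Qed.
Lemma swap_other i j kap : j != lo i -> j != hi i ->
  black (swap i kap) j = black kap j.
Proof.
by move=> jl jh; rewrite /black tnth_mktuple /simple tpermD // eq_sym.
Qed.
Lemma swapK i : involutive (swap i).
Proof.
move=> kap; apply/val_inj/eq_from_tnth => j.
rewrite -!/(black _ _).
have [->|jl] := eqVneq j (lo i); first by rewrite swap_lo swap_hi.
have [->|jh] := eqVneq j (hi i); first by rewrite swap_hi swap_lo.
by rewrite !swap_other.
Qed.

Lemma dot_eps i kap : dot i * eps kap = eps kap * dot i.
Proof. by have := rel_eq (web_xe i kap); rewrite !pclsM. Qed.
Lemma sigma_eps i kap : sigma i * eps kap = eps (swap i kap) * sigma i.
Proof. by have := rel_eq (web_se i kap); rewrite !pclsM. Qed.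
Lemma eps_sigma i kap : eps kap * sigma i = sigma i * eps (swap i kap).
Proof. by rewrite sigma_eps swapK. Qed.

Lemma swap_same i kap : black kap (lo i) = black kap (hi i) -> swap i kap = kap.
Proof.
move=> E; apply/val_inj/eq_from_tnth => j; rewrite -!/(black _ _).
have [->|jl] := eqVneq j (lo i); first by rewrite swap_lo.
have [->|jh] := eqVneq j (hi i); first by rewrite swap_hi.
by rewrite swap_other.
Qed.

Lemma swap_braid (i j : 'I_(l + n).-1) kap : j = i.+1 :> nat ->
  let kap' := swap i (swap j (swap i kap)) in
  [/\ kap' = swap j (swap i (swap j kap)), black kap' (lo i) = black kap (hi j),
      black kap' (hi i) = black kap (hi i) & black kap' (hi j) = black kap (lo i)].
Proof.
move=> ij; have hl : lo j = hi i by apply/val_inj; rewrite /= ij.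
have ab : lo i != hi i by rewrite -val_eqE /= neq_ltn ltnSn.
have ac : lo i != hi j by rewrite -val_eqE /= ij neq_ltn ltnS leqnSn.
have bc : hi i != hi j by rewrite -val_eqE /= ij neq_ltn ltnSn.
have bE m kap0 z : black (swap m kap0) z = black kap0 (simple m z).
  by rewrite /black tnth_mktuple.
have [ba ca cb] : [/\ hi i != lo i, hi j != lo i & hi j != hi i].
  by split; rewrite eq_sym.
have tE := (tpermL, tpermR, tpermD ac bc, tpermD ba ca).
split; rewrite ?bE /simple ?hl.
- apply/val_inj/eq_from_tnth => z; rewrite -!/(black _ _) !bE /simple hl.
  have [->|za] := eqVneq z (lo i); first by rewrite !tE.
  have [->|zb] := eqVneq z (hi i); first by rewrite !tE.
  have [->|zc] := eqVneq z (hi j); first by rewrite !tE.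
  by rewrite !tpermD // eq_sym.
- by rewrite !tE.
- by rewrite !tE.
- by rewrite !tE.
Qed.

Lemma web_flip a b : cong web_rel a b -> cong web_rel (flip a) (flip b).
Proof.
apply: flip_cong => {a b} a b ab; apply/pclsP.
have brE (i j m : 'I_(l + n).-1) kap : eps kap * (sigma i * (sigma j * sigma m)) =
    sigma i * (sigma j * sigma m) * eps (swap m (swap j (swap i kap))).
  by rewrite !mulrA eps_sigma -(mulrA _ (eps _)) eps_sigma mulrA
    -(mulrA _ (eps _)) eps_sigma !mulrA.
have sqE i kap : eps kap * (sigma i * sigma i) = sigma i * sigma i * eps kap.
  by rewrite !mulrA eps_sigma -(mulrA _ (eps _)) eps_sigma swapK !mulrA.
have E := (pclsM, pclsD, pclsN); have M := mulrA.
have commx i kap : GRing.comm (eps kap) (dot i).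
  by rewrite /GRing.comm dot_eps.
have exs i j kap : eps kap * (dot j * sigma i) =
    dot j * sigma i * eps (swap i kap).
  by rewrite M -dot_eps -M eps_sigma M.
have esx i j kap : eps kap * (sigma i * dot j) =
    sigma i * dot j * eps (swap i kap).
  by rewrite M eps_sigma -M -dot_eps M.
have comms i kap : black kap (lo i) = black kap (hi i) ->
    GRing.comm (eps kap) (sigma i).
  by move=> kE; rewrite /GRing.comm eps_sigma swap_same.
case: ab => /=; rewrite ?E -?/(eps _) -?/(dot _) -?/(sigma _).
- move=> kap kap'; have := rel_eq (web_orth kap' kap); rewrite pclsM => ->.
  by rewrite eq_sym; case: eqVneq => [->|].
- have -> : flip (\big[@Add k web_gen/0%T]_kap e kap) =
      \big[@Add k web_gen/0%T]_kap e kap.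
    exact: (big_morph (@flip k web_gen) (fun _ _ => erefl) erefl).
  exact/rel_eq/web_one.
- by move=> i kap; rewrite !E; symmetry; apply: dot_eps.
- by move=> i kap; rewrite !E; apply: eps_sigma.
- move=> i kap ki; rewrite E -/(eps _) -/(dot _) -dot_eps -pclsM.
  exact/rel_eq/web_x_red.
- move=> i kap kl kh; rewrite E -/(eps _) -/(sigma _) eps_sigma -pclsM.
  by apply/rel_eq/web_s_red; rewrite ?swap_lo ?swap_hi.
- by move=> i j; apply/rel_eq/web_xx.
- by move=> i j il ih; symmetry; apply/rel_eq/web_xs.
- by move=> i j ij; symmetry; apply/rel_eq/web_ss.
- move=> i kap kl kh; rewrite !E sqE.
  by have := rel_eq (web_bb_sq kl kh); rewrite !E.
- move=> i kap kl kh; have := rel_eq (web_bb_l kl kh); rewrite !E => {2}<-.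
  apply: commrB; apply: commrM; by [exact: commx | apply: comms; rewrite kl kh].
- move=> i kap kl kh; have := rel_eq (web_bb_r kl kh); rewrite !E => {2}<-.
  apply: commrB; apply: commrM; by [exact: commx | apply: comms; rewrite kl kh].
- move=> i j kap ij kE; have [s1 b1 b2 b3] := swap_braid kap ij.
  have := rel_eq (@web_braid i j (swap i (swap j (swap i kap))) ij _).
  rewrite !E !brE -s1 !M; apply; rewrite b1 b2 b3.
  by move: kE; do 3!case: (black kap _).
- move=> i j kap ij k1 k2 k3; have [s1 b1 b2 b3] := swap_braid kap ij.
  have := rel_eq (web_brb ij k1 k2 k3).
  rewrite !E mulrBr !brE -s1 -mulrBl !M.
  suff -> : swap i (swap j (swap i kap)) = kap by [].
  have hl : lo j = hi i by apply/val_inj; rewrite /= ij.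
  apply/val_inj/eq_from_tnth => z; rewrite -!/(black _ _).
  have [->|za] := eqVneq z (lo i); first by rewrite b1 k1 k3.
  have [->|zb] := eqVneq z (hi i); first by rewrite b2.
  have [->|zc] := eqVneq z (hi j); first by rewrite b3 k1 k3.
  by rewrite !swap_other ?hl.
- move=> i kap kl kh; rewrite !E sqE.
  have := rel_eq (web_rb_sq kl kh); rewrite !E => ->.
  by rewrite [RHS]commx.
- move=> i kap kl kh; have := @web_br_x i (swap i kap).
  rewrite swap_lo swap_hi => /(_ kh kl)/rel_eq; rewrite !E => br.
  by rewrite [LHS]exs [RHS]esx -br.
- move=> i kap kl kh; rewrite !E sqE.
  have := rel_eq (web_br_sq kl kh); rewrite !E => ->.
  by rewrite [RHS]commx.
- move=> i kap kl kh; have := @web_rb_x i (swap i kap).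
  rewrite swap_lo swap_hi => /(_ kh kl)/rel_eq; rewrite !E => br.
  by rewrite [LHS]exs [RHS]esx -br.
- move=> i kap i0 ki; exact/rel_eq/(web_cyc i0).
Qed.

Lemma star_cls a : star (cls a) = cls (flip a).
Proof. by apply/pclsP/web_flip; exact: prep_cong. Qed.

Lemma starM u v : star (u * v) = star v * star u.
Proof.
elim/pcls_ind: u => a; elim/pcls_ind: v => b.
by rewrite -pclsM !star_cls /= pclsM.
Qed.

Lemma star_linear (c : k) u v : star (c *: u + v) = c *: star u + star v.
Proof.
elim/pcls_ind: u => a; elim/pcls_ind: v => b.
by rewrite -pclsZ -pclsD !star_cls /= pclsD pclsZ.
Qed.

Lemma flipK (a : term k web_gen) : flip (flip a) = a.
Proof. by elim: a => //= [a -> b ->|a ->|a -> b ->|c a ->]. Qed.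

Lemma starK : involutive star.
Proof. by elim/pcls_ind=> a; rewrite !star_cls flipK. Qed.

Lemma star_eps kap : star (eps kap) = eps kap.
Proof. exact: star_cls. Qed.
Lemma star_dot i : star (dot i) = dot i.
Proof. exact: star_cls. Qed.
Lemma star_sigma i : star (sigma i) = sigma i.
Proof. exact: star_cls. Qed.

(* Strand end points carry labels: [inl i] is the [i]th red strand and [inr j]
   the black strand labelled by [j]. *)
Definition label : Type := ('I_l + 'I_l)%type.
HB.instance Definition _ := Finite.on label.
Definition is_black (a : label) : bool := if a is inr _ then true else false.

Definition lseq := {s : (l + n).-tuple label | count is_black s == n}.

Lemma colours_proof (s : lseq) : count id (map_tuple is_black (val s)) == n.
Proof. by rewrite count_map; exact: (valP s). Qed.
Definition colours (s : lseq) : colouring :=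
  @exist _ (fun t : (l + n).-tuple bool => count id t == n) _ (colours_proof s).

(* A word [:: i_1; ...; i_m] stands for the diagram sigma_(i_1) ... sigma_(i_m),
   with sigma_(i_m) at the bottom; [strand w z] is the top end of the strand
   starting at the bottom position [z]. *)
Definition strand (w : seq 'I_(l + n).-1) (z : 'I_(l + n)) : 'I_(l + n) :=
  foldr (fun i z' => simple i z') z w.

Definition joins (bot top : lseq) (w : seq 'I_(l + n).-1) : Prop :=
  forall z, tnth (val top) (strand w z) = tnth (val bot) z.

Definition minimal (bot top : lseq) (w : seq 'I_(l + n).-1) : Prop :=
  joins bot top w /\ forall w', joins bot top w' -> (size w <= size w')%N.

(* The dotless diagrams joining equal labels of [bot] and [top] in a minimal
   way: those with the least number of crossings. *)
Definition diagrams (bot top : lseq) : set web :=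
  [set d | exists w, minimal bot top w /\
                     d = (\prod_(i <- w) sigma i) * eps (colours bot)].

(* Boxes and slots are numbered from 0: the position called [i] here is the
   position [i + 1] of the usual numbering. *)
Definition bpart := {lam : {ffun 'I_l -> bool} | (\sum_i lam i)%N == n}.
HB.instance Definition _ := SubFinite.on bpart.

Definition has_box (lam : bpart) (i : 'I_l) : bool := val lam i.
Definition box (lam : bpart) := {i : 'I_l | has_box lam i}.
HB.instance Definition _ (lam : bpart) := SubFinite.on (box lam).

Lemma boxes_proof (lam : bpart) : size (enum (has_box lam)) == n.
Proof.
rewrite -cardE -sum1_card big_mkcond -[X in _ == X](eqP (valP lam)).
by apply/eqP; apply: eq_bigr => i _; rewrite /has_box unfold_in; case: (val lam i).
Qed.
(* Box positions in increasing order. *)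
Definition boxes (lam : bpart) : n.-tuple 'I_l := Tuple (boxes_proof lam).
Definition jpos (lam : bpart) (m : 'I_n) : 'I_l := tnth (boxes lam) m.

(* Each red strand [i] followed by black strands labelled by [F i]. *)
Definition layout_seq (F : 'I_l -> seq 'I_l) : seq label :=
  flatten [seq inl i :: [seq inr j | j <- F i] | i <- enum 'I_l].

Lemma layout_size (F : 'I_l -> seq 'I_l) :
  (\sum_i size (F i))%N = n -> size (layout_seq F) == (l + n)%N.
Proof.
move=> FE; rewrite size_flatten /shape -map_comp sumnE big_map.
rewrite (eq_bigr (fun i => (1 + size (F i))%N)) => [|i _]; last first.
  by rewrite /= size_map.
by rewrite big_enum big_split /= sum1_card card_ord FE.
Qed.

Lemma layout_count (F : 'I_l -> seq 'I_l) :
  (\sum_i size (F i))%N = n -> count is_black (layout_seq F) == n.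
Proof.
move=> FE; rewrite count_flatten -map_comp sumnE big_map.
rewrite (eq_bigr (fun i => size (F i))) => [|i _]; last first.
  by rewrite /= count_map add0n (eq_count (a2 := predT)) ?count_predT.
by rewrite big_enum FE.
Qed.

Definition layout F (FE : (\sum_i size (F i))%N = n) : lseq :=
  @exist _ (fun t : (l + n).-tuple label => count is_black t == n)
    (Tuple (layout_size FE)) (layout_count FE).

Definition shape_row (lam : bpart) (i : 'I_l) : seq 'I_l :=
  if has_box lam i then [:: i] else [::].
Lemma shape_proof lam : (\sum_i size (shape_row lam i))%N = n.
Proof.
rewrite -[RHS](eqP (valP lam)); apply: eq_bigr => i _.
by rewrite /shape_row /has_box; case: (val lam i).
Qed.
(* The sequence kappa_lambda, each black strand being labelled by its box. *)
Definition shape_seq (lam : bpart) : lseq := layout (shape_proof lam).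

Definition kappa (lam : bpart) : colouring := colours (shape_seq lam).
Definition epsP (lam : bpart) : web := eps (kappa lam).

(* All reds left of all blacks. *)
Lemma kappa0_proof :
  count id (cat_tuple (nseq_tuple l false) (nseq_tuple n true)) == n.
Proof. by rewrite count_cat !count_nseq /= mul0n mul1n. Qed.
Definition kappa0 : colouring :=
  @exist _ (fun t : (l + n).-tuple bool => count id t == n) _ kappa0_proof.
Definition eps0 : web := eps kappa0.

(* kappa_0, with the black strands labelled by the boxes of [lam] in order. *)
Lemma straight_proof (lam : bpart) :
  count is_black (cat_tuple [tuple (inl i : label) | i < l]
                            (map_tuple inr (boxes lam))) == n.
Proof.
rewrite count_cat count_map (eq_count (a2 := pred0)) // count_pred0 add0n.
rewrite count_map (eq_count (a2 := predT)) // count_predT.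
exact/eqP/size_tuple.
Qed.
Definition straight_seq (lam : bpart) : lseq :=
  @exist _ (fun t : (l + n).-tuple label => count is_black t == n) _
    (straight_proof lam).

(* Fillings by 0, ..., n-1 instead of 1, ..., n. *)
Definition is_tab (lam mu : bpart) (t : {ffun box mu -> 'I_n}) : bool :=
  [&& injectiveb t, [forall m : 'I_n, m \in codom t] &
      [forall b : box mu, (jpos lam (t b) <= val b)%N]].
Definition Tab (lam mu : bpart) := {t : {ffun box mu -> 'I_n} | is_tab lam t}.
HB.instance Definition _ lam mu := SubFinite.on (Tab lam mu).

Definition TD (lam : bpart) : finType := {mu : bpart & Tab lam mu}.

(* The [m]th black bottom point is the one labelled [jpos lam m] in
   [shape_seq lam]. *)
Definition D_row lam (s : TD lam) (i : 'I_l) : seq 'I_l :=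
  if insub i is Some b then [:: jpos lam (val (tagged s) b)] else [::].
Lemma D_row_proof lam (s : TD lam) : (\sum_i size (D_row s i))%N = n.
Proof.
rewrite -[RHS](eqP (valP (tag s))); apply: eq_bigr => i _.
by rewrite /D_row; case: insubP => [b ib _|/negbTE ib]; move: ib; rewrite /has_box => ->.
Qed.
Definition D_top lam (s : TD lam) : lseq := layout (D_row_proof s).

(* The letter [(a, i)] is the letter (a+1)_(i+1).  Bounding [a] by [n] is no
   restriction: in a multi-standard tableau an occurrence of a_i comes with
   [a] distinct letters in [n] boxes. *)
Definition letter : finType := ('I_n * 'I_l)%type.

Definition is_multistd (lam : bpart) (t : {ffun box lam -> letter}) : bool :=
  [&& injectiveb t,
      [forall b : box lam, (val b <= (t b).2)%N] &
      [forall b : box lam, forall a : 'I_n,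
         (a < (t b).1)%N ==> ((a, (t b).2) \in codom t)]].

(* [TB lam] is T'_lam and [TB1 lam] below is T''_lam. *)
Definition TB (lam : bpart) := {t : {ffun box lam -> letter} | is_multistd t}.
HB.instance Definition _ lam := SubFinite.on (TB lam).

Definition is_TB1 lam (t : TB lam) : bool :=
  [forall b : box lam, ((val t b).1 == 0 :> nat)%N].
Definition TB1 (lam : bpart) := {t : TB lam | is_TB1 t}.
HB.instance Definition _ lam := SubFinite.on (TB1 lam).

Definition B_row lam (t : TB lam) (i : 'I_l) : seq 'I_l :=
  [seq val b | b <- sort (fun b b' : box lam => (val t b).1 <= (val t b').1)%N
                         (enum [pred b : box lam | (val t b).2 == i])].
Lemma B_row_proof lam (t : TB lam) : (\sum_i size (B_row t i))%N = n.
Proof.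
transitivity #|{: box lam}|.
  rewrite -sum1_card (partition_big (fun b => (val t b).2) predT) //=.
  apply: eq_bigr => i _.
  by rewrite size_map size_sort -cardE -sum1_card; apply: eq_bigl.
rewrite card_sig -[RHS](eqP (valP lam)) -sum1_card big_mkcond.
by apply: eq_bigr => i _; rewrite unfold_in /has_box; case: (val lam i).
Qed.
(* The entry sequence, black strands being labelled by boxes. *)
Definition entry_seq lam (t : TB lam) : lseq := layout (B_row_proof t).

Definition is_D_family (D : forall lam, TD lam -> web) : Prop :=
  forall lam (s : TD lam), diagrams (shape_seq lam) (D_top s) (D lam s).

Definition is_B_family (B : forall lam, TB lam -> web) : Prop :=
  forall lam (t : TB lam), diagrams (shape_seq lam) (entry_seq t) (B lam t).

(* From the half diagrams to the elements indexed by pairs of tableaux. *)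
Definition dbl (T : bpart -> Type) (C : forall lam, T lam -> web)
  (lam : bpart) (s t : T lam) : web := C lam s * star (C lam t).

(* eps(mu) W eps(nu), summed over all mu and nu: this is END_W(Q), acting on
   Q = sum of the eps(lam) W by left multiplication. *)
Definition corner : set web :=
  [set w | exists f : bpart -> bpart -> web,
     w = \sum_mu \sum_nu epsP mu * f mu nu * epsP nu].

(* HOM_W(eps0 W, Q). *)
Definition homQ : set web :=
  [set u | exists f : bpart -> web, u = \sum_lam epsP lam * f lam * eps0].

End Webster.

Section QuiverSchur.
Variables (k : fieldType) (l n : nat).
Local Notation NH := (NH k l n).
Local Notation bpart := (bpart l n).
Local Notation web := (web k l n).

(* Since [jpos] counts from 0, the exponent is l - j_m(lam). *)
Definition Ggen (lam : bpart) : NH :=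
  \prod_(m < n) nh_y k l m ^+ (l - (jpos lam m).+1).
Definition G (lam : bpart) : set NH := [set Ggen lam * a | a in setT].

Definition Gshift (lam : bpart) : int :=
  \sum_(m < n) ((jpos lam m).+1)%:Z - (n * l)%:Z.

Definition GG_pred : {pred {ffun bpart -> NH}} :=
  fun v => `[< forall lam, G lam (v lam) >].

Lemma GG_closed : submod_closed GG_pred.
Proof.
split=> [|c u v /asboolP uG /asboolP vG]; apply/asboolP => lam.
  by exists 0; rewrite ?mulr0 ?ffunE.
have [[a _ ua] [b _ vb]] := (uG lam, vG lam).
exists (c *: a + b) => //.
by rewrite !ffunE -ua -vb mulrDr presented_scaleAr.
Qed.

HB.instance Definition _ :=
  GRing.isSubmodClosed.Build k {ffun bpart -> NH} GG_pred GG_closed.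

(* The direct sum of the G(lam). *)
Definition GG : Type := {v : {ffun bpart -> NH} | v \in GG_pred}.
HB.instance Definition _ := SubChoice.on GG.
HB.instance Definition _ := [SubChoice_isSubLmodule of GG by <:].

Lemma GG_right_proof (v : GG) (a : NH) :
  [ffun lam => val v lam * a] \in GG_pred.
Proof.
apply/asboolP => lam; have /asboolP/(_ lam) [b _ vb] := valP v.
by exists (b * a); rewrite // ffunE -vb mulrA.
Qed.
Definition GG_right (v : GG) (a : NH) : GG :=
  @exist _ (fun w => w \in GG_pred) _ (GG_right_proof v a).

Definition GG_homogeneous (d : int) : set GG :=
  [set v : GG | forall lam, nh_homogeneous (d - Gshift lam) (val v lam)].

(* Homogeneous NH-endomorphisms of degree [d]. *)
Definition schur_homogeneous (d : int) : set (GG -> GG) :=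
  [set F | [/\ forall u v, F (u + v) = F u + F v,
               forall v a, F (GG_right v a) = GG_right (F v) a &
               forall d' v, GG_homogeneous d' v ->
                            GG_homogeneous (d' + d) (F v)]].

(* The quiver Schur algebra: sums of homogeneous endomorphisms. *)
Definition schur : set (GG -> GG) :=
  [set F | exists (N : nat) (d : 'I_N -> int) (H : 'I_N -> GG -> GG),
     (forall i, schur_homogeneous (d i) (H i)) /\
     F = (fun v => \sum_(i < N) H i v)].

(* [Phi] is the isomorphism from END_W(Q) to the quiver Schur algebra, relative
   to the isomorphism [nu] from NH to eps0 W eps0 and to the diagrams [theta];
   only the values of [Phi] on [corner] matter. *)
Record schur_iso (nu : NH -> web) (theta : bpart -> web)
    (Phi : web -> GG -> GG) : Prop := SchurIso {
  nu_linear : forall (c : k) u v, nu (c *: u + v) = c *: nu u + nu v;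
  nu_mul : forall u v, nu (u * v) = nu u * nu v;
  nu_one : nu 1 = eps0 k l n;
  nu_y : forall i, nu (nh_y k l i) = dot k (rshift l i) * eps0 k l n;
  nu_psi : forall (i : 'I_n.-1) (i' : 'I_(l + n).-1), i' = (l + i)%N :> nat ->
    nu (nh_psi k l i) = sigma k i' * eps0 k l n;
  nu_bij : set_bij setT [set eps0 k l n * w * eps0 k l n | w in setT] nu;
  theta_diagram : forall lam,
    diagrams (shape_seq lam) (straight_seq lam) (theta lam);
  theta_bij : forall lam,
    set_bij [set epsP k lam * w * eps0 k l n | w in setT] (nu @` G lam)
            (fun u => theta lam * u);
  Phi_linear : forall (c : k) f g, corner f -> corner g ->
    Phi (c *: f + g) = c *: Phi f + Phi g;
  Phi_mul : forall f g, corner f -> corner g -> Phi (f * g) = Phi f \o Phi g;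
  Phi_one : Phi (\sum_lam epsP k lam) = id;
  Phi_bij : set_bij (@corner k l n) schur Phi;
  (* an element [u] of HOM_W(eps0 W, Q) corresponds to the [v] in GG with
     components theta_lam u, and [f] acts on it by composition *)
  Phi_action : forall f u (v : GG), corner f -> homQ u ->
    (forall lam, theta lam * u = nu (val v lam)) ->
    forall lam, theta lam * (f * u) = nu (val (Phi f v) lam)
}.

End QuiverSchur.

(* [C] is a cellular basis, with respect to the order [le] and the
   anti-involution [inv], of the algebra formed by the subspace [A] of [V]
   with the product [mul]. *)
Record cellular_basis (k : fieldType) (V : lmodType k) (A : set V)
    (mul : V -> V -> V) (inv : V -> V) (L : finType) (le : rel L)
    (T : L -> finType) (C : forall lam, T lam -> T lam -> V) : Prop :=
  CellularBasis {
  cell_refl : reflexive le;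
  cell_antisym : antisymmetric le;
  cell_trans : transitive le;
  cell_inv_mem : forall a, A a -> A (inv a);
  cell_inv_linear : forall (c : k) a b, A a -> A b ->
    inv (c *: a + b) = c *: inv a + inv b;
  cell_inv_mul : forall a b, A a -> A b -> inv (mul a b) = mul (inv b) (inv a);
  cell_invK : forall a, A a -> inv (inv a) = a;
  cell_mem : forall lam s t, A (C lam s t);
  cell_span : forall a, A a -> exists r : forall lam, T lam -> T lam -> k,
    a = \sum_lam \sum_(s : T lam) \sum_(t : T lam) r lam s t *: C lam s t;
  cell_free : forall r : forall lam, T lam -> T lam -> k,
    \sum_lam \sum_(s : T lam) \sum_(t : T lam) r lam s t *: C lam s t = 0 ->
    forall lam s t, r lam s t = 0;
  cell_inv : forall lam s t, inv (C lam s t) = C lam t s;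
  (* the coefficients [r] do not depend on [t] *)
  cell_mul : forall a, A a -> forall lam, exists r : T lam -> T lam -> k,
    forall s t, exists q : forall mu, T mu -> T mu -> k,
      (forall mu u v, q mu u v != 0 -> le mu lam && (mu != lam)) /\
      mul a (C lam s t) = \sum_(s' : T lam) r s' s *: C lam s' t +
        \sum_mu \sum_(u : T mu) \sum_(v : T mu) q mu u v *: C mu u v
}.

(* Main.v *)
Require Import Defs.
From HB Require Import structures.
From mathcomp Require Import all_boot all_order perm all_algebra.
From mathcomp Require Import all_classical.
From mathcomp Require Import zify.

(* Let s be a lam-tableau of shape mu.  Putting into the box j_k(lam) of lam the
   letter 1_c, where c is the position of the box of mu filled with k, gives a
   multi-standard tableau s' whose entry sequence is the top sequence of D^s,
   so that D^s and B^s' are minimal diagrams with the same end points.  Black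
   strands only move to the right across red ones, hence in every pair of
   crossing strands the one starting on the left is black.  Three pairwise
   crossing strands are therefore coloured bbb or bbr, their braid relation has
   no error term, and by Matsumoto's argument all minimal diagrams agree.

   The entry sequence of a multi-standard tableau is some kappa_mu only if no
   letter a_i with a > 1 occurs.  So the sum of the idempotents eps(mu) kills
   all B_st but those with s and t in T'', and truncating by it turns the
   cellular basis of W into one of END_W(Q), which Phi carries over. *)

Set Implicit Arguments.
Unset Strict Implicit.
Unset Printing Implicit Defensive.

Import Order.TTheory GRing.Theory Num.Theory.

Local Open Scope classical_set_scope.
Local Open Scope ring_scope.

(** * Reduced words of permutations, obtained by sorting *)

Section SortingWords.
Variable m : nat.
Implicit Types (q : 'S_m) (i j : 'I_m.-1) (w : seq 'I_m.-1).

Lemma val_simple i (x : 'I_m) : simple i x =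
  (if x == i :> nat then i.+1 else if x == i.+1 :> nat then i : nat else x) :> nat.
Proof.
rewrite /simple; case: tpermP => [->|->|/eqP xl /eqP xh] /=.
- by rewrite eqxx.
- by rewrite eqxx gtn_eqF.
- by rewrite -val_eqE in xl; rewrite -val_eqE in xh; rewrite (negbTE xl) (negbTE xh).
Qed.

Lemma simple_lt i (x y : 'I_m) : (x < y)%N ->
  (simple i x < simple i y)%N \/ x = lo i /\ y = hi i.
Proof.
move=> xy; have [/andP[xl yh]|ne] := boolP ((x == lo i) && (y == hi i)).
  by right; rewrite (eqP xl) (eqP yh).
left; move: ne; rewrite !val_simple -!val_eqE /=.
by repeat case: ifP; lia.
Qed.

Definition descent q i : bool := (q (hi i) < q (lo i))%N.

Definition inversions q : {set 'I_m * 'I_m} :=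
  [set xy : 'I_m * 'I_m | (xy.1 < xy.2)%N && (q xy.2 < q xy.1)%N].

Lemma descent_simple q i : descent (simple i * q) i = ~~ descent q i.
Proof.
rewrite /descent !permM /simple tpermL tpermR -leqNgt [RHS]leq_eqVlt.
by case: eqP => // /val_inj/perm_inj/(congr1 val) /=; lia.
Qed.

(** Applied to both entries of a pair, the transposition carries the inversions of [q] other than
    [(lo i, hi i)] onto those of [simple i * q]. *)
Lemma inversions_descent q i : descent q i ->
  #|inversions (simple i * q)|.+1 = #|inversions q|.
Proof.
move=> di; pose f (xy : 'I_m * 'I_m) := (simple i xy.1, simple i xy.2).
have sK : involutive (simple i) by move=> x; rewrite /simple tpermK.
have fK : involutive f by case=> x y; rewrite /f /= !sK.
have -> : inversions (simple i * q) = f @: (inversions q :\ (lo i, hi i)).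
  apply/setP => -[x y]; rewrite -[(x, y)]fK mem_imset; last exact: inv_inj.
  rewrite !inE /= !permM !sK xpair_eqE.
  case h: (q (simple i y) < q (simple i x))%N; last by rewrite !andbF.
  rewrite !andbT.
  apply/idP/idP => [xy|/andP[ne xy]].
    have [sxy|[xE yE]] := simple_lt i xy.
      rewrite sxy andbT; apply/negP => /andP[/eqP xE /eqP yE].
      have : x = hi i by rewrite -[x]sK xE /simple tpermL.
      have : y = lo i by rewrite -[y]sK yE /simple tpermR.
      by move=> yE' xE'; move: xy; rewrite xE' yE' /= ltnNge leqnSn.
    by move: h; rewrite xE yE /simple tpermL tpermR ltnNge ltnW.
  have [|[xE yE]] := simple_lt i xy; first by rewrite !sK.
  by rewrite xE yE !eqxx in ne.
rewrite card_imset; last exact: inv_inj.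
by rewrite [RHS](cardsD1 (lo i, hi i)) !inE /= ltnSn -/(descent q i) di.
Qed.

Lemma inversions_step q i :
  (#|inversions q| <= #|inversions (simple i * q)|.+1)%N.
Proof.
have [/inversions_descent <- //|nd] := boolP (descent q i).
have := @inversions_descent (simple i * q) i; rewrite descent_simple => /(_ nd).
by rewrite mulgA /simple tperm2 mul1g => <-; rewrite 2?leqW.
Qed.

(** Without descents [q] is strictly increasing, and then so is its inverse. A strictly increasing
    map moves no point down; applied to both maps, this leaves only the identity. *)
Lemma descent_exists q : q != 1%g -> exists i, descent q i.
Proof.
case: (pickP (descent q)) => [i|nd /eqP[]]; first by exists i.
apply/permP => x; rewrite perm1.
have step i : (q (lo i) < q (hi i))%N.
  by have := descent_simple q i; rewrite nd /descent !permM /simple tpermL tpermR.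
have mono (z y : 'I_m) : (z < y)%N -> (q z < q y)%N.
  case: y => y ym /=; elim: y ym => // y IH ym; rewrite ltnS leq_eqVlt => zy.
  have ym' : (y < m.-1)%N by case: (m) ym.
  have e : Ordinal ym = hi (Ordinal ym') by apply/val_inj.
  have e' : Ordinal (ltnW ym) = lo (Ordinal ym') by apply/val_inj.
  case/orP: zy => [/eqP zy|zy]; last first.
    by apply: ltn_trans (IH (ltnW ym) zy) _; rewrite e e'.
  by rewrite e (_ : z = Ordinal (ltnW ym)) ?e' //; apply/val_inj.
have incr (r : 'S_m) : {homo r : y z / (y < z)%N} -> forall z : 'I_m, (z <= r z)%N.
  move=> rh [z zm] /=; elim: z zm => // z IH zm.
  by apply: leq_ltn_trans (IH (ltnW zm)) _; apply: rh.
apply/val_inj/eqP; rewrite /= eqn_leq incr ?andbT //.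
rewrite -{2}[x](permK q); apply: incr => y z yz.
rewrite ltnNge leq_eqVlt; apply/negP => /orP[/eqP/val_inj/perm_inj E|/mono].
  by rewrite E ltnn in yz.
by rewrite !permKV ltnNge ltnW.
Qed.

(* Read from the top, each crossing of [w] removes an inversion of [q], and none
   is left at the bottom: [w] is a reduced word. *)
Fixpoint sorts q w : bool :=
  if w is i :: u then descent q i && sorts (simple i * q) u else q == 1%g.

Lemma sorting_word q : exists w, sorts q w.
Proof.
move: {2}#|_| (erefl #|inversions q|) => N.
elim/ltn_ind: N q => N IH q qN.
have [->|/descent_exists[i di]] := eqVneq q 1%g; first by exists [::] => /=.
have [w ws] := IH _ (eq_leq (etrans (inversions_descent di) qN)) _ erefl.
by exists (i :: w) => /=; rewrite di.
Qed.

Lemma sorts_size q w : sorts q w -> size w = #|inversions q|.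
Proof.
elim: w q => [|i w IH] q /= => [/eqP ->|/andP[di /IH ->]]; last first.
  exact: inversions_descent.
symmetry; apply/eqP; rewrite cards_eq0; apply/eqP/setP => -[x y].
by rewrite !inE !perm1 /=; case: ltngtP.
Qed.

(* [source w x] is the bottom end of the strand of [w] ending at the top position
   [x], see [source_strand] below. *)
Definition source w : 'S_m := (\prod_(i <- w) simple i)%g.

Lemma sorts_source q w : sorts q w -> source w = q.
Proof.
elim: w q => [|i w IH] q /= => [/eqP ->|/andP[_ /IH E]].
  by rewrite /source big_nil.
by rewrite /source big_cons -/(source w) E mulgA /simple tperm2 mul1g.
Qed.

(** Each crossing changes the number of inversions by one, so equality forces every crossing to
    remove one when the word is read from the top. *)
Lemma reduced_sorts w :
  (#|inversions (source w)| <= size w)%N /\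
  (#|inversions (source w)| = size w -> sorts (source w) w).
Proof.
elim: w => [|i w [le_w eq_w]].
  rewrite /source big_nil /= leqn0 cards_eq0 eqxx; split=> //.
  by apply/eqP/setP => -[x y]; rewrite !inE !perm1; case: ltngtP.
have sE : (simple i * source (i :: w))%g = source w.
  by rewrite /source big_cons mulgA /simple tperm2 mul1g.
have := inversions_step (source (i :: w)) i; rewrite sE => le1.
split=> /= [|E]; first exact: leq_trans le1 _.
rewrite sE; have [di|nd] := boolP (descent _ i).
  by apply: eq_w; apply/eq_add_S; rewrite -E -(inversions_descent di) sE.
(* Otherwise [source w] would have two inversions more than [w] has letters. *)
have := @inversions_descent (simple i * source (i :: w)) i.
rewrite descent_simple nd mulgA /simple tperm2 mul1g -/(simple i) sE E => /(_ isT).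
lia.
Qed.

Lemma braid_simple_lo i j : j = i.+1 :> nat ->
  [/\ hi i = lo j, simple i (lo i) = lo j, simple i (lo j) = lo i
    & simple i (hi j) = hi j].
Proof.
move=> ij; have hl : hi i = lo j by apply/val_inj; rewrite /= ij.
by rewrite -hl /simple tpermL tpermR tpermD // -val_eqE /= ij; lia.
Qed.

Lemma braid_simple_hi i j : j = i.+1 :> nat ->
  [/\ simple j (lo i) = lo i, simple j (lo j) = hi j & simple j (hi j) = lo j].
Proof.
by move=> ij; rewrite /simple tpermL tpermR tpermD // -val_eqE /= ij; lia.
Qed.

Lemma braid_simpleC i j : j = i.+1 :> nat ->
  (simple i * simple j * simple i = simple j * simple i * simple j)%g.
Proof.
move=> ij; have [hl ia ib ic] := braid_simple_lo ij.
have [ja jb jc] := braid_simple_hi ij.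
apply/permP => z; rewrite !permM.
have [<-|za] := eqVneq (lo i) z; first by rewrite ja !ia jb ic.
have [<-|zb] := eqVneq (lo j) z; first by rewrite jb ic jc ib ja ia.
have [<-|zc] := eqVneq (hi j) z; first by rewrite ic jc ib ja.
by rewrite /simple hl !(tpermD za zb, tpermD zb zc).
Qed.

Lemma far_simple i j : (i.+1 < j)%N ->
  [/\ simple j (lo i) = lo i, simple j (hi i) = hi i,
      simple i (lo j) = lo j & simple i (hi j) = hi j].
Proof.
by move=> ij; split; apply/val_inj; rewrite /= val_simple /=; do !case: ifP; lia.
Qed.

Lemma far_simpleC i j : (i.+1 < j)%N -> (simple i * simple j = simple j * simple i)%g.
Proof.
move=> ij; apply/permP => x; rewrite !permM; apply/val_inj.
by rewrite /= !val_simple; repeat case: ifP; lia.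
Qed.

End SortingWords.

(** * Dotless diagrams as words in the crossings, and uniqueness of minimal ones *)

Section Words.
Variables (k : fieldType) (l n : nat).
Implicit Types (kap : colouring l n) (i j : 'I_(l + n).-1) (w u v : seq 'I_(l + n).-1).

Definition word w kap : web k l n := (\prod_(i <- w) sigma k i) * eps k kap.

Lemma word_cons i w kap : word (i :: w) kap = sigma k i * word w kap.
Proof. by rewrite /word big_cons mulrA. Qed.

Lemma web_eq a b : @web_rel k l n a b ->
  pcls (@web_rel k l n) a = pcls (@web_rel k l n) b.
Proof. by move=> ab; apply/pclsP/cong_rel. Qed.

Lemma eps_orth kap kap' :
  eps k kap * eps k kap' = if kap == kap' then eps k kap else 0.
Proof.
have := web_eq (web_orth k kap kap').
by rewrite pclsM -!/(eps _ _) => ->; case: ifP.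
Qed.

Lemma sigma_far i j : (i.+1 < j)%N -> sigma k i * sigma k j = sigma k j * sigma k i.
Proof. by move=> ij; have := web_eq (web_ss k ij); rewrite !pclsM. Qed.

(** Two black letters on the left leave only the types bbb and bbr, whose braid relation has no
    error term. *)
Lemma sigma_braid i j kap : j = i.+1 :> nat ->
    black kap (lo i) -> black kap (hi i) ->
  sigma k i * (sigma k j * (sigma k i * eps k kap)) =
  sigma k j * (sigma k i * (sigma k j * eps k kap)).
Proof.
move=> ij bl bh; have := web_eq (@web_braid k l n i j kap ij _).
rewrite !pclsM !mulrA; apply; rewrite bl bh.
by case: (black kap (hi j)).
Qed.

Lemma black_swap i kap x : black (swap i kap) x = black kap (simple i x).
Proof. by rewrite /black tnth_mktuple. Qed.

(** Moving the bottom idempotent up through the crossings permutes its letters: a top position gets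
    the colour of the bottom end of its strand. This gives access to the colours at an intermediate
    level of a diagram. *)
Lemma word_eps w kap :
  exists2 kap', forall x, black kap' x = black kap (source w x) &
    word w kap = eps k kap' * word w kap.
Proof.
elim: w => [|i w [kap' kE wE]].
  exists kap => [x|]; first by rewrite /source big_nil perm1.
  by rewrite /word big_nil mul1r eps_orth eqxx.
exists (swap i kap') => [x|].
  by rewrite black_swap kE /source big_cons permM.
by rewrite word_cons mulrA -sigma_eps -mulrA -wE.
Qed.

(* Of two crossing strands, the one starting on the left is black; this excludes
   the braid relation of type [brb], which has an error term. *)
Definition left_black (q : 'S_(l + n)) kap : Prop :=
  forall x y : 'I_(l + n), (x < y)%N -> (q y < q x)%N -> black kap (q y).

(** Two strands that still cross below the removed top crossing already cross in [q]. *)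
Lemma left_black_descent (q : 'S_(l + n)) kap i :
  left_black q kap -> descent q i -> left_black (simple i * q) kap.
Proof.
move=> qb di x y xy; rewrite !permM; have [/qb //|[-> ->]] := simple_lt i xy.
by rewrite /simple tpermL tpermR; move: di; rewrite /descent; lia.
Qed.

(* Matsumoto's argument: if the top crossings [i] and [j] of the two words
   differ, both words are compared with words starting with the longest element
   of the parabolic subgroup generated by [i] and [j]. *)
Lemma sorting_word_unique (q : 'S_(l + n)) kap w w' :
  left_black q kap -> sorts q w -> sorts q w' -> word w kap = word w' kap.
Proof.
have [N] := ubnP (size w); elim: N w w' q => // N IH w w' q wN qb qw qw'.
have ss : size w = size w' by rewrite (sorts_size qw) (sorts_size qw').
have {IH} IH (q1 : 'S_(l + n)) w1 w2 : (size w1 < size w)%N -> left_black q1 kap ->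
    sorts q1 w1 -> sorts q1 w2 -> word w1 kap = word w2 kap.
  by move=> sw; apply: IH; apply: leq_trans sw _.
case: w w' ss IH {wN} qw qw' => [|i u] [|j v] //= [uv] IH /andP[di qu] /andP[dj qv].
(* If the top crossings agree, the induction hypothesis applies below them; the two other cases are
   symmetric. *)
wlog ij : i j u v uv IH di qu dj qv / (i < j)%N => [wl|].
  case: (ltngtP i j) => [ij|ij|/val_inj ij]; first exact: wl.
    by symmetry; apply: wl; rewrite // -uv.
  by rewrite !word_cons -ij; rewrite -ij in qv; rewrite (IH _ _ _ _ _ qu qv) //;
     apply: left_black_descent.
have qbi := left_black_descent qb di; have qbj := left_black_descent qb dj.
have [far|near] := ltnP i.+1 j.
  have [jl jh il ih] := far_simple far.
  (* Here [i :: j :: x] and [j :: i :: x] both sort [q]. Each shares its top crossing with one of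
     the given words, and the two differ by a far commutation. *)
  have [x qx] := sorting_word (simple j * (simple i * q)).
  have qjx : sorts (simple i * q) (j :: x).
    by rewrite /= qx /descent !permM il ih -/(descent q j) dj.
  have qix : sorts (simple j * q) (i :: x).
    by rewrite /= mulgA far_simpleC // -mulgA qx /descent !permM jl jh -/(descent q i) di.
  rewrite !word_cons (IH _ _ _ _ qbi qu qjx) ?ltnSn //.
  rewrite (IH _ _ _ _ qbj qv qix) -?uv ?ltnSn //.
  by rewrite !word_cons mulrA sigma_far // -mulrA.
have {near ij} ij : j = i.+1 :> nat by apply/eqP; rewrite eqn_leq ij near.
have [b_ij ia ib ic] := braid_simple_lo ij.
have [ja jb jc] := braid_simple_hi ij.
have E := (permM, ic, ja, ia, ib, jb, jc).
(* Likewise [i :: j :: i :: x] and [j :: i :: j :: x] both sort [q], and they differ by a braid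
   relation above [x]. *)
have [x qx] := sorting_word (simple i * (simple j * (simple i * q))).
have bE := congr1 (fun s : 'S_(l + n) => s * q)%g (braid_simpleC ij).
rewrite -!mulgA in bE.
have qba : (q (lo j) < q (lo i))%N by rewrite -b_ij.
have qca := ltn_trans dj qba.
have qjx : sorts (simple i * q) (j :: i :: x).
  by rewrite /= qx /descent b_ij !E qca; move: dj; rewrite /descent => ->.
have qix : sorts (simple j * q) (i :: j :: x).
  by rewrite /= -bE qx /descent b_ij !E qca qba.
have [kap' kE xE] := word_eps x kap.
rewrite !word_cons (IH _ _ _ _ qbi qu qjx) ?ltnSn //.
rewrite (IH _ _ _ _ qbj qv qix) -?uv ?ltnSn //.
have F (u1 u2 u3 : web k l n) : u1 * (u2 * (u3 * (eps k kap' * word x kap))) =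
    u1 * (u2 * (u3 * eps k kap')) * word x kap by rewrite !mulrA.
rewrite !word_cons xE !F; congr (_ * _).
have [ab bc] : (lo i < lo j)%N /\ (lo j < hi j)%N by rewrite /= ij.
(* Just above [x], the strands at [lo i] and [lo j] come from the bottom positions [q (hi j)] and
   [q (lo j)]. Both cross the strand from [q (lo i)] and start to its left, so both are black. *)
apply: sigma_braid; rewrite // kE (sorts_source qx) ?b_ij !E.
  exact: (qb (lo i)) (ltn_trans ab bc) qca.
exact: (qb (lo i)) ab qba.
Qed.

Lemma source_strand w z : source w (strand w z) = z.
Proof.
elim: w => [|i w IH] /=; first by rewrite /source big_nil perm1.
by rewrite /source big_cons permM -/(source w) /simple tpermK.
Qed.

Lemma strand_source w x : strand w (source w x) = x.
Proof. by apply: (@perm_inj _ (source w)); rewrite source_strand. Qed.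

Implicit Types (bot top : lseq l n).

Lemma joinsP bot top w :
  joins bot top w <-> forall x, tnth (val top) x = tnth (val bot) (source w x).
Proof.
split=> J x; first by rewrite -J strand_source.
by rewrite J source_strand.
Qed.

(** A sorting word of the same permutation joins the same labels, so a minimal word has no more
    letters than there are inversions. *)
Lemma minimal_sorts bot top w : minimal bot top w -> sorts (source w) w.
Proof.
move=> [/joinsP J min_w]; have [le_w eq_w] := reduced_sorts w; apply: eq_w.
apply/eqP; rewrite eqn_leq le_w /=.
have [w' w's] := sorting_word (source w).
rewrite -(sorts_size w's); apply: min_w; apply/joinsP.
by rewrite (sorts_source w's).
Qed.

Lemma joins_source bot top w w' : uniq (val bot) ->
  joins bot top w -> joins bot top w' -> source w = source w'.
Proof.
move=> /tuple_uniqP inj /joinsP J /joinsP J'; apply/permP => x.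
by apply: inj; rewrite -J -J'.
Qed.

Lemma black_colours (s : lseq l n) x : black (colours s) x = is_black (tnth (val s) x).
Proof. by rewrite /black tnth_map. Qed.

Lemma diagrams_eps bot top d : diagrams (k := k) bot top d ->
  d = eps k (colours top) * d * eps k (colours bot).
Proof.
move=> [w [[/joinsP J _] ->]]; rewrite -/(word w (colours bot)).
have [kap kE ->] := word_eps w (colours bot).
have -> : kap = colours top.
  apply/val_inj/eq_from_tnth => x; rewrite -!/(black _ _) kE !black_colours.
  by rewrite J.
by rewrite /word !mulrA !eps_orth eqxx -!mulrA eps_orth eqxx.
Qed.

Lemma tnth_pairwise (T : Type) (r : rel T) (N : nat) (s : N.-tuple T) (i j : 'I_N) :
  pairwise r s -> (i < j)%N -> r (tnth s i) (tnth s j).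
Proof.
have x0 := tnth s i; move=> /(pairwiseP x0) rs ij; rewrite !(tnth_nth x0).
by apply: rs; rewrite ?inE ?size_tuple.
Qed.

(** The relations record what the order of two labels at the bottom ([rb]) or at the top ([rt])
    implies. Crossing strands occur in opposite orders at the two ends, so the condition linking
    [rb] and [rt] yields [left_black]. *)
Lemma diagrams_unique (rb rt : rel (label l)) bot top d d' :
  uniq (val bot) -> pairwise rb (val bot) -> pairwise rt (val top) ->
  (forall a a', rb a a' -> rt a' a -> is_black a) ->
  diagrams (k := k) bot top d -> diagrams (k := k) bot top d' -> d = d'.
Proof.
move=> ub pb pt rP [w [mw ->]] [w' [mw' ->]].
have sw := minimal_sorts mw; have sw' := minimal_sorts mw'.
case: mw mw' => J _ [J' _]; move/(joins_source ub J): J' => E.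
apply: (sorting_word_unique _ sw); last by rewrite E.
move=> x y xy qyx; move/joinsP: J => J.
rewrite black_colours -J; apply: (rP _ (tnth (val top) x)).
  by rewrite !J; apply: tnth_pairwise pb qyx.
exact: tnth_pairwise pt xy.
Qed.

End Words.

(** * Label sequences cut into rows by the red strands *)

Section Layouts.
Variables (l n : nat).
Implicit Types (F : 'I_l -> seq 'I_l) (i j : 'I_l) (lam mu : bpart l n).

Definition layout_row F i : seq (label l) := inl i :: [seq inr j | j <- F i].

Lemma layout_pairwise (r : rel (label l)) F :
  (forall i, pairwise r (layout_row F i)) ->
  (forall i j, (i < j)%N -> allrel r (layout_row F i) (layout_row F j)) ->
  pairwise r (layout_seq F).
Proof.
move=> r1 r2; have : pairwise (relpre val ltn) (enum 'I_l).
  rewrite -sorted_pairwise; last by move=> x y z; apply: ltn_trans.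
  by rewrite -sorted_map val_enum_ord iota_ltn_sorted.
rewrite /layout_seq; elim: (enum _) => //= i s IH /andP[/allP si /IH ps].
change (pairwise r (layout_row F i ++ flatten [seq layout_row F i | i <- s])).
rewrite pairwise_cat r1 ps !andbT.
apply/allrelP => a a' ia /flatten_mapP[j js ja'].
by apply: (allrelP (r2 i j (si _ js))).
Qed.

Lemma layout_seq_rows F F' : F =1 F' -> layout_seq F = layout_seq F'.
Proof. by move=> E; rewrite /layout_seq; congr flatten;
  apply: eq_map => i; rewrite E.
Qed.

Lemma colours_layout F (FE : (\sum_i size (F i))%N = n) :
  val (val (colours (layout FE))) =
  flatten [seq false :: nseq (size (F i)) true | i <- enum 'I_l].
Proof.
rewrite /= /layout_seq map_flatten -map_comp; congr flatten; apply: eq_map => i /=.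
by rewrite -map_comp; elim: (F i) => //= _ s [->].
Qed.

(** The row lengths can be read off as the gaps between consecutive red letters. *)
Lemma colours_layout_eq F F' FE FE' :
  colours (@layout l n F FE) = colours (@layout l n F' FE') <->
  forall i, size (F i) = size (F' i).
Proof.
split=> [/(congr1 (fun c => val (val c)))|E]; last first.
  by apply/val_inj/val_inj; rewrite !colours_layout; congr flatten;
    apply: eq_map => i; rewrite E.
rewrite !colours_layout => E i; have : i \in enum 'I_l by rewrite mem_enum.
elim: (enum _) E => // j s IH /= [E].
(* The leading red letter has been stripped. In the last row no [false] remains, and [index] then
   returns the length of the sequence, which is again the row length. *)
have idx (G : 'I_l -> seq 'I_l) : index false (nseq (size (G j)) true ++
     flatten [seq false :: nseq (size (G i)) true | i <- s]) = size (G j).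
  rewrite index_cat mem_nseq andbF size_nseq.
  by case: (s) => [|? ?] /=; rewrite addn0.
have Ej : size (F j) = size (F' j) by rewrite -[LHS]idx E idx.
move: E; rewrite Ej => /eqP; rewrite eqseq_cat // eqxx => /eqP/IH{}IH.
by rewrite inE => /orP[/eqP ->|/IH].
Qed.

(* Relates a label to every later one in a sequence where each black label is at
   most the number of the last red strand before it. *)
Definition left_bounded (a a' : label l) : bool :=
  match a, a' with
  | inl i, inl j | inr i, inl j => (i < j)%N
  | _, _ => true
  end.

(* Likewise, with each black label at least that number. *)
Definition right_bounded (a a' : label l) : bool :=
  match a, a' with
  | inl i, inl j => (i < j)%N
  | inl i, inr j => (i <= j)%N
  | _, _ => true
  end.

Lemma layout_left_bounded F : (forall i j, j \in F i -> (j <= i)%N) ->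
  pairwise left_bounded (layout_seq F).
Proof.
move=> FP; apply: layout_pairwise => [i|i j ij].
  rewrite /=; apply/andP; split; first by apply/allP => _ /mapP[j _ ->].
  by apply/(pairwiseP (inl i)) => x y; rewrite !inE size_map => xs ys _;
    do 2!rewrite (nth_map i) //.
apply/allrelP => a a'; rewrite !inE => /orP[/eqP ->|/mapP[x xF ->]]
  /orP[/eqP ->|/mapP[y yF ->]] //=.
by apply: leq_ltn_trans ij; apply: FP.
Qed.

Lemma layout_right_bounded F : (forall i j, j \in F i -> (i <= j)%N) ->
  pairwise right_bounded (layout_seq F).
Proof.
move=> FP; apply: layout_pairwise => [i|i j ij].
  rewrite /=; apply/andP; split; first by apply/allP => _ /mapP[j /FP ij ->].
  by apply/(pairwiseP (inl i)) => x y; rewrite !inE size_map => xs ys _;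
    do 2!rewrite (nth_map i) //.
apply/allrelP => a a'; rewrite !inE => /orP[/eqP ->|/mapP[x xF ->]]
  /orP[/eqP ->|/mapP[y yF ->]] //=.
by apply: leq_trans (ltnW ij) _; apply: FP.
Qed.

Lemma shape_seq_uniq lam : uniq (val (shape_seq lam)).
Proof.
rewrite uniq_pairwise; apply: layout_pairwise => [i|i j ij].
  by rewrite /layout_row /shape_row; case: has_box.
rewrite /layout_row /shape_row; apply/allrelP => a a'.
by do 2!case: has_box => /=; rewrite !inE; repeat case/orP; move=> /eqP ->;
  repeat case/orP; move=> /eqP -> //=; apply/negP => /eqP [E]; rewrite E ltnn in ij.
Qed.

End Layouts.

(** * The bijection between the tableaux indexing the two bases *)

Section TableauBijection.
Variables (l n : nat).
Implicit Types (lam mu : bpart l n).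

Definition to_box lam i (ib : has_box lam i) : box lam :=
  @exist _ (fun i => is_true (has_box lam i)) i ib.

Lemma box_rank_proof lam (b : box lam) : (index (val b) (boxes lam) < n)%N.
Proof.
by rewrite -[X in (_ < X)%N](size_tuple (boxes lam)) index_mem mem_enum;
  exact: (valP b).
Qed.
Definition box_rank lam (b : box lam) : 'I_n := Ordinal (box_rank_proof b).

Lemma jpos_rank lam (b : box lam) : jpos lam (box_rank b) = val b.
Proof.
rewrite /jpos (tnth_nth (val b)) nth_index // mem_enum; exact: (valP b).
Qed.

Lemma jpos_inj lam : injective (jpos lam).
Proof. by apply/tuple_uniqP; exact: enum_uniq. Qed.

Lemma jpos_box lam m : has_box lam (jpos lam m).
Proof. by have := mem_tnth m (boxes lam); rewrite mem_enum. Qed.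
Definition jbox lam m : box lam := to_box (jpos_box lam m).

Lemma jboxK lam : cancel (jbox lam) (@box_rank lam).
Proof. by move=> m; apply: (@jpos_inj lam); rewrite jpos_rank. Qed.

Lemma box_rankK lam : cancel (@box_rank lam) (jbox lam).
Proof. by move=> b; apply/val_inj; rewrite /= jpos_rank. Qed.

Section TabOfTD.
Variables (lam : bpart l n) (s : TD lam).
Let t := val (tagged s).

Lemma tab_inj : injective t.
Proof. by apply/injectiveP; case/and3P: (valP (tagged s)). Qed.
Lemma tab_codom m : m \in codom t.
Proof. by case/and3P: (valP (tagged s)) => _ /forallP. Qed.
Lemma tab_le c : (jpos lam (t c) <= val c)%N.
Proof. by case/and3P: (valP (tagged s)) => _ _ /forallP. Qed.

Definition tab_box m : box (tag s) := iinv (tab_codom m).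
Lemma tab_boxK : cancel tab_box t.
Proof. by move=> m; apply: f_iinv. Qed.
Lemma tabK : cancel t tab_box.
Proof. by move=> c; apply: tab_inj; rewrite tab_boxK. Qed.

Lemma D_row_box c : D_row s (val c) = [:: jpos lam (t c)].
Proof. by rewrite /D_row valK. Qed.
Lemma D_row_nil i : ~~ has_box (tag s) i -> D_row s i = [::].
Proof. by move=> ni; rewrite /D_row insubN. Qed.

Lemma D_row_le i j : j \in D_row s i -> (j <= i)%N.
Proof.
have [ib|/D_row_nil ->] := boolP (has_box (tag s) i); last by [].
by rewrite (D_row_box (to_box ib)) inE => /eqP ->; apply: tab_le.
Qed.

Lemma size_D_row i : size (D_row s i) = has_box (tag s) i.
Proof.
have [ib|/D_row_nil ->] := boolP (has_box (tag s) i); last by [].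
by rewrite (D_row_box (to_box ib)).
Qed.

(* ['I_n] may be empty; [m] witnesses that it is not. *)
Definition zero_letter (m : 'I_n) : 'I_n :=
  Ordinal (leq_ltn_trans (leq0n m) (ltn_ord m)).

Definition std_fun : {ffun box lam -> letter l n} :=
  [ffun b => (zero_letter (box_rank b), val (tab_box (box_rank b)))].

(** That the box filled with [k] lies weakly to the right of [j_k(lam)] is exactly the condition on
    alphabets; the condition on smaller letters is void, as only first letters of alphabets
    occur. *)
Lemma std_multistd : is_multistd std_fun.
Proof.
apply/and3P; split.
- apply/injectiveP => b b'; rewrite !ffunE => /(congr1 snd)/val_inj E.
  by apply: (can_inj (@box_rankK lam)); apply: (can_inj tab_boxK).
- apply/forallP => b; rewrite ffunE /=.
  by apply: leq_trans (tab_le _); rewrite tab_boxK jpos_rank.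
- by apply/forallP => b; apply/forallP => a; rewrite ffunE.
Qed.
Definition std_TB : TB lam :=
  @exist _ (fun t => is_true (is_multistd t)) _ std_multistd.

Lemma std_TB1 : is_TB1 std_TB.
Proof. by apply/forallP => b; rewrite /= ffunE. Qed.
Definition std : TB1 lam := @exist _ (fun t => is_true (is_TB1 t)) _ std_TB1.

End TabOfTD.

Section TabOfTB1.
Variables (lam : bpart l n) (u : TB1 lam).
Let t := val (val u).

Lemma std_letter b : (t b).1 = 0%N :> nat.
Proof. by have /forallP/(_ b)/eqP := valP u. Qed.

Lemma std_inj b b' : (t b).2 = (t b').2 -> b = b'.
Proof.
case/and3P: (valP (val u)) => /injectiveP inj _ _ E; apply: inj.
apply/eqP; rewrite -pair_eqE /pair_eq /= -/t E eqxx andbT -val_eqE /=.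
by rewrite !std_letter.
Qed.

Lemma std_le (b : box lam) : (val b <= (t b).2)%N.
Proof. by case/and3P: (valP (val u)) => _ /forallP. Qed.

Lemma B_row_box b : B_row (val u) (t b).2 = [:: val b].
Proof.
rewrite /B_row (_ : enum _ = [:: b]) //.
rewrite -(enum1 b); apply: eq_enum => b'; rewrite !inE /=.
by apply/eqP/eqP => [/std_inj|->].
Qed.

Lemma B_row_nil i : (forall b, (t b).2 != i) -> B_row (val u) i = [::].
Proof.
move=> ni; rewrite /B_row (_ : enum _ = [::]) //.
by rewrite -(enum0 (box lam)); apply: eq_enum => b; rewrite !inE (negbTE (ni b)).
Qed.

(** The boxes of the shape whose [kappa] is the colour sequence of [entry_seq (val u)]. *)
Definition std_boxes : {ffun 'I_l -> bool} := [ffun i => [exists b, (t b).2 == i]].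

Lemma size_B_row i : size (B_row (val u) i) = std_boxes i.
Proof.
rewrite ffunE; case: existsP => [[b /eqP <-]|ni]; first by rewrite B_row_box.
by rewrite B_row_nil // => b; apply/eqP => E; apply: ni; exists b; apply/eqP.
Qed.

Lemma std_shape_proof : (\sum_i std_boxes i)%N == n.
Proof.
rewrite -[X in _ == X](B_row_proof (val u)).
by apply/eqP/eq_bigr => i _; rewrite size_B_row.
Qed.
Definition std_shape : bpart l n := 
  @exist _ (fun lam : {ffun 'I_l -> bool} => is_true (\sum_i lam i == n)%N) _
    std_shape_proof.

Lemma std_shape_box (c : box std_shape) : exists b, (t b).2 == val c.
Proof. by have := valP c; rewrite /has_box /= ffunE => /existsP. Qed.
Definition std_box c : box lam := xchoose (std_shape_box c).
Lemma std_boxE c : (t (std_box c)).2 = val c.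
Proof. exact/eqP/(xchooseP (std_shape_box c)). Qed.

(** The inverse of [std_fun]: the box at [c] receives the rank of the box of [lam] whose letter
    comes from alphabet [c]. *)
Definition tab_fun : {ffun box std_shape -> 'I_n} := [ffun c => box_rank (std_box c)].

Lemma tab_is_tab : is_tab lam tab_fun.
Proof.
apply/and3P; split.
- apply/injectiveP => c c'; rewrite !ffunE => /(can_inj (@box_rankK lam)) E.
  by apply/val_inj; rewrite -!std_boxE E.
- apply/forallP => m; apply/codomP.
  have cb : has_box std_shape (t (jbox lam m)).2.
    by rewrite /has_box /= ffunE; apply/existsP; exists (jbox lam m).
  exists (to_box cb); rewrite ffunE -[LHS](jboxK lam); congr box_rank.
  by apply: std_inj; rewrite std_boxE.
- apply/forallP => c; rewrite ffunE jpos_rank -std_boxE; exact: std_le.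
Qed.
Definition tab : TD lam :=
  Tagged (Tab lam) (@exist _ (fun t => is_true (is_tab lam t)) _ tab_is_tab).

Lemma tab_row : D_row tab =1 B_row (val u).
Proof.
move=> i; have [ib|ni] := boolP (has_box std_shape i); last first.
  rewrite D_row_nil // B_row_nil // => b; apply: contraNneq ni => E.
  by rewrite /has_box /= ffunE; apply/existsP; exists b; apply/eqP.
pose c : box std_shape := to_box ib.
rewrite (@D_row_box _ tab c) /= ffunE jpos_rank.
by have := B_row_box (std_box c); rewrite std_boxE.
Qed.

End TabOfTB1.

Lemma std_row lam (s : TD lam) : B_row (val (std s)) =1 D_row s.
Proof.
move=> i; have [ib|ni] := boolP (has_box (tag s) i); last first.
  rewrite D_row_nil // B_row_nil // => b; apply: contraNneq ni => <-.
  by rewrite /= ffunE; exact: valP.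
pose c : box (tag s) := to_box ib; rewrite (D_row_box c).
have := B_row_box (std s) (jbox lam (val (tagged s) c)).
by rewrite /= ffunE /= jboxK tabK.
Qed.

Lemma D_row_inj lam (s s' : TD lam) : D_row s =1 D_row s' -> s = s'.
Proof.
move=> E; have mE : tag s = tag s'.
  apply/val_inj/ffunP => i; have := congr1 size (E i).
  by rewrite !size_D_row /has_box; case: (val (tag s) i); case: (val (tag s') i).
case: s s' mE E => mu t [mu' t'] /= mE; move: t'; case: _ / mE => t' E.
congr existT; apply/val_inj/ffunP => c; apply: (@jpos_inj lam).
have := E (val c); rewrite (@D_row_box _ (Tagged (Tab lam) t)).
by rewrite (@D_row_box _ (Tagged (Tab lam) t')) => -[].
Qed.

Lemma B_row_inj lam (u u' : TB1 lam) : B_row (val u) =1 B_row (val u') -> u = u'.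
Proof.
move=> E; apply/val_inj/val_inj/ffunP => b.
apply/eqP; rewrite -pair_eqE /pair_eq /= -val_eqE /= !std_letter eqxx /=.
have := E (val (val u) b).2; rewrite B_row_box.
have [/existsP[b' /eqP b'E]|/existsPn ni] :=
  boolP [exists b', (val (val u') b').2 == (val (val u) b).2].
  by rewrite -b'E B_row_box => /(congr1 (head (val b)))/val_inj ->.
by rewrite B_row_nil.
Qed.

(** Both constructions preserve the rows of the top sequence, and on either side a tableau is
    determined by its rows. *)
Lemma std_bij lam : bijective (@std lam).
Proof.
exists (@tab lam) => [s|u].
  by apply: D_row_inj => i; rewrite tab_row std_row.
by apply: B_row_inj => i; rewrite std_row tab_row.
Qed.

Lemma entry_seq_std lam (s : TD lam) : entry_seq (val (std s)) = D_top s.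
Proof. by apply/val_inj/val_inj; apply: layout_seq_rows; apply: std_row. Qed.

Lemma colours_D_top lam (s : TD lam) : colours (D_top s) = kappa (tag s).
Proof.
apply/colours_layout_eq => i; rewrite size_D_row /shape_row.
by case: has_box.
Qed.

(** A letter [a_i] with [a > 1] comes with [1_i], which puts at least two black strands in row [i],
    while each row of [kappa mu] has at most one. *)
Lemma colours_entry_seq lam (t : TB lam) mu :
  colours (entry_seq t) = kappa mu -> is_TB1 t.
Proof.
move/colours_layout_eq => E; apply/forallP => b; apply: contraT => nb.
case/and3P: (valP t) => /injectiveP inj _ /forallP/(_ b)/forallP.
move=> /(_ (zero_letter (val t b).1)); rewrite /= lt0n nb => /codomP[b' b'E].
have := E (val t b).2; rewrite size_map size_sort -cardE => cE.
have : (1 < #|[pred c | (val t c).2 == (val t b).2]|)%N.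
  apply/card_gt1P; exists b, b'; rewrite !inE -b'E eqxx; split=> //.
  by apply: contraNneq nb => bb; rewrite bb -b'E.
by rewrite cE /shape_row; case: has_box.
Qed.

End TableauBijection.

(** * Transport of a cellular basis along an isomorphism and a reindexing of tableaux *)

Section Transport.
Variables (k : fieldType) (V V' : lmodType k) (A : set V) (A' : set V').
Variables (mul : V -> V -> V) (mul' : V' -> V' -> V').
Variables (inv : V -> V) (inv' : V' -> V') (Phi : V -> V').
Hypotheses (A0 : A 0) (A_linear : forall c a b, A a -> A b -> A (c *: a + b)).
Hypothesis A_mul : forall a b, A a -> A b -> A (mul a b).
Hypothesis Phi_linear : forall c a b, A a -> A b ->
  Phi (c *: a + b) = c *: Phi a + Phi b.
Hypothesis Phi_mul : forall a b, A a -> A b -> Phi (mul a b) = mul' (Phi a) (Phi b).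
Hypothesis Phi_bij : set_bij A A' Phi.
Hypothesis Phi_inv : forall a, A a -> inv' (Phi a) = Phi (inv a).

Lemma transport0 : Phi 0 = 0.
Proof.
have := Phi_linear 1 A0 A0; rewrite !scale1r addr0 => /eqP.
by rewrite -{1}[Phi 0]addr0 (inj_eq (addrI _)) => /eqP <-.
Qed.

Lemma transport_scale c a : A a -> A (c *: a) /\ Phi (c *: a) = c *: Phi a.
Proof.
move=> Aa; have := Phi_linear c Aa A0; have := A_linear c Aa A0.
by rewrite transport0 !addr0.
Qed.

(** Since [Phi] is assumed linear on [A] only, membership of the partial sums in [A] is carried
    through the induction. *)
Lemma transport_sum (I : finType) (F : I -> V) : (forall i, A (F i)) ->
  A (\sum_i F i) /\ Phi (\sum_i F i) = \sum_i Phi (F i).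
Proof.
move=> AF; pose R v v' := A v /\ Phi v = v'.
apply: (big_ind2 R) => [|u u' v v' [Au <-] [Av <-]|i _]; rewrite /R //.
  by rewrite transport0.
have := Phi_linear 1 Au Av; have := A_linear 1 Au Av.
by rewrite !scale1r.
Qed.

Variables (L : finType) (T T' : L -> finType).
Implicit Types (lam : L).
Variables (C : forall lam, T lam -> T lam -> V).
Hypothesis A_C : forall lam s t, A (@C lam s t).

Lemma transport_row lam (r : T lam -> k) t :
  A (\sum_s r s *: C s t) /\ Phi (\sum_s r s *: C s t) = \sum_s r s *: Phi (C s t).
Proof.
have [|? ->] := @transport_sum (T lam) (fun s => r s *: C s t).
  by move=> s; case: (transport_scale (r s) (A_C s t)).
split=> //; apply: eq_bigr => s _; by case: (transport_scale (r s) (A_C s t)).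
Qed.

Lemma transport_comb (r : forall lam, T lam -> T lam -> k) :
  A (\sum_lam \sum_(s : T lam) \sum_(t : T lam) r lam s t *: C s t) /\
  Phi (\sum_lam \sum_(s : T lam) \sum_(t : T lam) r lam s t *: C s t) =
  \sum_lam \sum_(s : T lam) \sum_(t : T lam) r lam s t *: Phi (C s t).
Proof.
have H1 lam s t := transport_scale (r lam s t) (A_C s t).
have H2 lam s := transport_sum (fun t => (H1 lam s t).1).
have H3 lam := transport_sum (fun s => (H2 lam s).1).
have [H4 ->] := transport_sum (fun lam => (H3 lam).1).
split=> //; apply: eq_bigr => lam _; rewrite (H3 lam).2; apply: eq_bigr => s _.
rewrite (H2 lam s).2; apply: eq_bigr => t _; exact: (H1 lam s t).2.
Qed.

Variables (f : forall lam, T' lam -> T lam).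
Hypothesis f_bij : forall lam, bijective (@f lam).

Lemma reindex_tableaux (W : nmodType) (F : forall lam, T lam -> T lam -> W) :
  \sum_lam \sum_(s : T lam) \sum_(t : T lam) F lam s t =
  \sum_lam \sum_(s : T' lam) \sum_(t : T' lam) F lam (f s) (f t).
Proof.
apply: eq_bigr => lam _; rewrite (reindex (@f lam)) /=; last exact: onW_bij.
by apply: eq_bigr => s _; rewrite (reindex (@f lam)) //=; exact: onW_bij.
Qed.

(** Writing the elements of [A'] as [Phi a] with [a] in [A] reduces the clauses to those for [C];
    freeness follows from injectivity of [Phi] on [A]. *)
Lemma cellular_transport (le : rel L) : cellular_basis A mul inv le C ->
  cellular_basis A' mul' inv' le (fun lam (s t : T' lam) => Phi (C (f s) (f t))).
Proof.
have [Phi_fun Phi_inj Phi_surj] := Phi_bij.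
have PC := transport_comb.
move=> [le_refl le_anti le_trans inv_mem inv_lin inv_mul invK
  C_mem C_span C_free C_inv C_mul].
have Asurj a : A' a -> exists2 b, A b & a = Phi b.
  by move=> /Phi_surj[b Ab <-]; exists b.
split=> //.
- by move=> _ /Asurj[a Aa ->]; rewrite Phi_inv //; apply/Phi_fun/inv_mem.
- move=> c _ _ /Asurj[a Aa ->] /Asurj[b Ab ->].
  rewrite -Phi_linear // !Phi_inv ?inv_lin ?Phi_linear //; try exact: inv_mem.
  exact: A_linear.
- move=> _ _ /Asurj[a Aa ->] /Asurj[b Ab ->].
  rewrite -Phi_mul // !Phi_inv ?inv_mul ?Phi_mul //; try exact: inv_mem.
  exact: A_mul.
- by move=> _ /Asurj[a Aa ->]; rewrite !Phi_inv ?invK //; apply: inv_mem.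
- by move=> lam s t; apply: Phi_fun.
- move=> _ /Asurj[a Aa ->]; have [r ->] := C_span a Aa.
  exists (fun lam s t => r lam (f s) (f t)).
  by rewrite (PC r).2 reindex_tableaux.
- move=> r r0.
  (* Inverses of all the [f lam] are chosen at once, to pull the coefficients back from [T'] to
     [T]. *)
  have g_ex lam : exists g : T lam -> T' lam, cancel g (@f lam) /\ cancel (@f lam) g.
    by case: (f_bij lam) => g fK gK; exists g.
  pose g lam := sval (cid (g_ex lam)).
  have [gK fK] : (forall lam, cancel (g lam) (@f lam)) /\
      (forall lam, cancel (@f lam) (g lam)).
    by split=> lam; case: (svalP (cid (g_ex lam))).
  have [Ac Pc] := PC (fun lam s t => r lam (g lam s) (g lam t)).
  move=> lam s t; rewrite -(fK lam s) -(fK lam t).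
  apply: (C_free (fun lam s t => r lam (g lam s) (g lam t))) => {lam s t}.
  apply: Phi_inj; rewrite ?inE ?transport0 //.
  rewrite Pc reindex_tableaux -[RHS]r0; apply: eq_bigr => lam _.
  by apply: eq_bigr => s _; apply: eq_bigr => t _; rewrite !fK.
- by move=> lam s t; rewrite Phi_inv ?C_inv.
move=> _ /Asurj[a Aa ->] lam; have [r rP] := C_mul a Aa lam.
exists (fun s t => r (f s) (f t)) => s t; have [q [qle qE]] := rP (f s) (f t).
exists (fun mu u v => q mu (f u) (f v)); split=> [mu u v|]; first exact: qle.
have [A1 P1] := transport_row (r^~ (f s)) (f t); have [A2 P2] := PC q.
rewrite -Phi_mul // qE -[X in Phi (X + _)]scale1r Phi_linear // scale1r P1 P2.
by rewrite reindex_tableaux (reindex (@f lam)) //; apply: onW_bij.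
Qed.

End Transport.

(** * Idempotent truncation of the Webster algebra to END_W(Q) *)

Section Corner.
Variables (k : fieldType) (l n : nat).
Local Notation web := (web k l n).
Local Notation bpart := (bpart l n).
Implicit Types (lam mu nu : bpart) (w : web).

(* The unit of END_W(Q). *)
Definition Qid : web := \sum_lam epsP k lam.

Lemma kappa_inj : injective (@kappa l n).
Proof.
move=> mu nu /colours_layout_eq E; apply/val_inj/ffunP => i; have := E i.
by rewrite /shape_row /has_box; case: (val mu i); case: (val nu i).
Qed.

Lemma Qid_kappa mu : Qid * epsP k mu = epsP k mu.
Proof.
rewrite /Qid mulr_suml (bigD1 mu) //= eps_orth eqxx big1 ?addr0 // => nu ne.
by rewrite eps_orth (inj_eq kappa_inj) (negbTE ne).
Qed.

Lemma Qid_other (c : colouring l n) :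
  (forall mu, c <> kappa mu) -> Qid * eps k c = 0.
Proof.
move=> ne; rewrite /Qid mulr_suml big1 // => mu _; rewrite eps_orth.
by case: eqP => // E; case: (ne mu).
Qed.

Lemma star0 : star (0 : web) = 0.
Proof. exact: star_cls. Qed.
Lemma starD (u v : web) : star (u + v) = star u + star v.
Proof. by rewrite -[u in LHS]scale1r star_linear scale1r. Qed.

Lemma star_Qid : star Qid = Qid.
Proof.
rewrite /Qid (big_morph (@star k l n) starD star0).
by apply: eq_bigr => lam _; apply: star_eps.
Qed.

Lemma epsP_Qid mu : epsP k mu * Qid = epsP k mu.
Proof.
by have := congr1 (@star k l n) (Qid_kappa mu); rewrite starM star_Qid star_eps.
Qed.

(** END_W(Q) is the Peirce corner of [Qid]; in this form its closure properties need no double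
    sums. *)
Lemma cornerP w : corner w <-> Qid * w = w /\ w * Qid = w.
Proof.
split=> [[f ->]|[w1 w2]].
  split; [rewrite mulr_sumr | rewrite mulr_suml]; apply: eq_bigr => mu _.
    rewrite mulr_sumr; apply: eq_bigr => nu _.
    by rewrite !mulrA Qid_kappa.
  rewrite mulr_suml; apply: eq_bigr => nu _.
  by rewrite -mulrA epsP_Qid.
exists (fun _ _ => w); rewrite -{1}w1 -{1}w2 /Qid mulr_suml; apply: eq_bigr => mu _.
by rewrite mulrA mulr_sumr.
Qed.

Lemma corner0 : corner (0 : web).
Proof. by apply/cornerP; rewrite mulr0 mul0r. Qed.

Lemma corner_linear (c : k) (u v : web) : corner u -> corner v -> corner (c *: u + v).
Proof.
move=> /cornerP[u1 u2] /cornerP[v1 v2]; apply/cornerP.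
by rewrite mulrDr mulrDl -presented_scaleAr -presented_scaleAl u1 u2 v1 v2.
Qed.

Lemma corner_mul (u v : web) : corner u -> corner v -> corner (u * v).
Proof.
move=> /cornerP[u1 u2] /cornerP[v1 v2]; apply/cornerP.
by rewrite mulrA u1 -mulrA v2.
Qed.

Lemma corner_star (u : web) : corner u -> corner (star u).
Proof.
move=> /cornerP[u1 u2]; apply/cornerP; rewrite -star_Qid -!starM.
by rewrite u1 u2.
Qed.

Lemma star_dbl (T : bpart -> Type) (C : forall lam, T lam -> web) lam (s t : T lam) :
  star (dbl C s t) = dbl C t s.
Proof. by rewrite /dbl starM starK. Qed.

Section BasisB.
Variable B : forall lam, TB lam -> web.
Hypothesis hB : is_B_family B.

(** The idempotent on top of [B t] is some [epsP mu] exactly when [t] lies in T''. For such [t] the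
    shape [mu] is found through the bijection [std]. *)
Lemma Qid_B lam (t : TB lam) : Qid * B t = if is_TB1 t then B t else 0.
Proof.
rewrite (diagrams_eps (hB t)) -!mulrA (mulrA Qid).
case: ifP => [t1|/negbT nt].
  pose u : TB1 lam := exist _ t t1; have [s _ sK] := std_bij lam.
  have -> : t = val (std (s u)) by rewrite sK.
  by rewrite entry_seq_std colours_D_top Qid_kappa.
rewrite Qid_other ?mul0r // => mu E.
by rewrite (colours_entry_seq E) in nt.
Qed.

Lemma Qid_dbl lam (s t : TB lam) :
  Qid * dbl B s t * Qid = if is_TB1 s && is_TB1 t then dbl B s t else 0.
Proof.
rewrite /dbl mulrA Qid_B -mulrA.
have -> : star (B t) * Qid = star (Qid * B t) by rewrite starM star_Qid.
by rewrite Qid_B; case: is_TB1; case: is_TB1; rewrite ?star0 ?mul0r ?mulr0.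
Qed.

Lemma sum_TB1 lam (W : nmodType) (F : TB lam -> W) :
  (forall s, ~~ is_TB1 s -> F s = 0) ->
  \sum_(s : TB lam) F s = \sum_(u : TB1 lam) F (val u).
Proof.
move=> F0; rewrite -(@big_rmcond _ _ _ _ _ (@is_TB1 l n lam)) //.
rewrite (reindex_omap (val : TB1 lam -> TB lam) insub); last first.
  by move=> s s1; rewrite insubT.
by apply: eq_bigl => u; rewrite valK eqxx (valP u).
Qed.

Lemma sandwich_sum (I : finType) (F : I -> web) (x : web) :
  x * (\sum_i F i) * x = \sum_i x * F i * x.
Proof. by rewrite mulr_sumr mulr_suml. Qed.

Lemma sandwich_scale (c : k) (w x : web) : x * (c *: w) * x = c *: (x * w * x).
Proof. by rewrite -presented_scaleAr -presented_scaleAl. Qed.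

Lemma Qid_comb1 lam (r : TB lam -> k) (t : TB lam) : is_TB1 t ->
  Qid * (\sum_(s : TB lam) r s *: dbl B s t) * Qid =
  \sum_(u : TB1 lam) r (val u) *: dbl B (val u) t.
Proof.
move=> t1; rewrite sandwich_sum.
under eq_bigr => s _ do
  rewrite sandwich_scale Qid_dbl t1 andbT.
rewrite sum_TB1 => [|s /negbTE ->]; last exact: scaler0.
by apply: eq_bigr => u _; rewrite (valP u).
Qed.

Lemma Qid_comb (r : forall lam, TB lam -> TB lam -> k) :
  Qid * (\sum_lam \sum_(s : TB lam) \sum_(t : TB lam) r lam s t *: dbl B s t) * Qid =
  \sum_lam \sum_(u : TB1 lam) \sum_(v : TB1 lam)
    r lam (val u) (val v) *: dbl B (val u) (val v).
Proof.
rewrite sandwich_sum; apply: eq_bigr => lam _.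
rewrite sandwich_sum.
under eq_bigr => s _.
  rewrite sandwich_sum.
  under eq_bigr => t _ do
    rewrite sandwich_scale Qid_dbl.
  over.
rewrite sum_TB1 => [|s /negbTE ns]; last first.
  by rewrite big1 // => t _; rewrite ns scaler0.
apply: eq_bigr => u _; rewrite sum_TB1 => [|s /negbTE ->]; last first.
  by rewrite andbF scaler0.
by apply: eq_bigr => v _; rewrite !(valP _).
Qed.

Lemma corner_dbl lam (u v : TB1 lam) : corner (dbl B (val u) (val v)).
Proof.
have := Qid_dbl (val u) (val v); rewrite (valP u) (valP v) /= => <-.
have Q2 : Qid * Qid = Qid.
  by rewrite /Qid mulr_sumr; apply: eq_bigr => mu _; rewrite Qid_kappa.
by apply/cornerP; rewrite !mulrA Q2 -!mulrA Q2.
Qed.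

(** Multiplying by [Qid] on both sides fixes the corner and cuts every combination of basis elements
    down to its terms in T''. *)
Lemma corner_cellular (le : rel bpart) :
  cellular_basis (V := web) setT (fun f g => f * g) (@star k l n) le (dbl B) ->
  cellular_basis (V := web) (@corner k l n) (fun f g => f * g) (@star k l n) le
    (fun lam (u v : TB1 lam) => dbl B (val u) (val v)).
Proof.
move=> [le_refl le_anti le_trans _ _ _ _ _ C_span C_free _ C_mul].
split=> //.
- exact: corner_star.
- by move=> c a b _ _; apply: star_linear.
- by move=> a b _ _; apply: starM.
- by move=> a _; apply: starK.
- by move=> lam u v; apply: corner_dbl.
- move=> a /cornerP[a1 a2]; have [r rE] := C_span a I.
  exists (fun lam u v => r lam (val u) (val v)).
  by rewrite -Qid_comb -rE a1.
- move=> r r0.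
  (* The coefficients are extended by 0 outside T'', so that freeness of the full basis applies. *)
  pose r' lam (s t : TB lam) : k :=
    if (insub s, insub t) is (Some u, Some v) then r lam u v else 0.
  have r'E lam u v : r' lam (val u) (val v) = r lam u v by rewrite /r' !valK.
  move=> lam u v; rewrite -r'E; apply: C_free; rewrite -[RHS]r0.
  apply: eq_bigr => mu _; rewrite sum_TB1 => [|s ns]; last first.
    by rewrite big1 // => t _; rewrite /r' insubN // scale0r.
  apply: eq_bigr => s _; rewrite sum_TB1 => [|t nt]; last first.
    by rewrite /r' valK insubN // scale0r.
  by apply: eq_bigr => t _; rewrite r'E.
- by move=> lam u v; rewrite star_dbl.
move=> a /cornerP[a1 a2] lam; have [r rP] := C_mul a I lam.
exists (fun u v => r (val u) (val v)) => u v.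
have [q [qle qE]] := rP (val u) (val v).
exists (fun mu s t => q mu (val s) (val t)); split=> [mu s t|]; first exact: qle.
(* Both sums are truncations, so the right-hand side is the expansion of the product in the full
   basis, multiplied by [Qid] on both sides. This does not change the product, whose factors lie in
   the corner. *)
rewrite -Qid_comb -(Qid_comb1 (r^~ (val u)) (valP v)) -mulrDl -mulrDr -qE.
have /cornerP[_] := corner_dbl u v; move: (dbl _ _ _) => c c2.
by rewrite !mulrA a1 -mulrA c2.
Qed.

End BasisB.
End Corner.

(** * Equality of the elements D and B, and its image in the quiver Schur algebra *)

Theorem corollary8p24 (k : fieldType) (p : nat) (hp : p \in [pchar k])
  (l n : nat) (hn : (n <= l)%N)
  (D : forall lam : bpart l n, TD lam -> web k l n) (hD : is_D_family D)
  (B : forall lam : bpart l n, TB lam -> web k l n) (hB : is_B_family B) :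
  exists phi : forall lam : bpart l n, TD lam -> TB1 lam,
    [/\ forall lam, bijective (phi lam),
        forall lam (s t : TD lam),
          corner (dbl D s t) /\
          dbl D s t = dbl B (val (phi lam s)) (val (phi lam t)) &
        forall (nu : NH k l n -> web k l n) (theta : bpart l n -> web k l n)
               (Phi : web k l n -> GG k l n -> GG k l n),
          schur_iso nu theta Phi ->
          (forall lam (s t : TD lam),
             schur (Phi (dbl D s t)) /\
             Phi (dbl D s t) =
             Phi (dbl B (val (phi lam s)) (val (phi lam t)))) /\
          (forall (le : rel (bpart l n)) (inv : (GG k l n -> GG k l n) ->
                                               (GG k l n -> GG k l n)),
             cellular_basis (V := web k l n) setT (fun f g => f * g)
               (@star k l n) le (dbl B) ->
             (forall w, corner w -> inv (Phi w) = Phi (star w)) ->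
             cellular_basis (@schur k l n) (fun F F' => F \o F') inv le
               (fun lam (s t : TD lam) => Phi (dbl D s t)))].
Proof.
have DB lam (s : TD lam) : D lam s = B lam (val (std s)).
  apply: (diagrams_unique (shape_seq_uniq lam) _ _ _ (hD _ s)).
  - apply: layout_right_bounded => i j; rewrite /shape_row.
    by case: has_box; rewrite // inE => /eqP ->.
  - by apply: layout_left_bounded => i j; apply: D_row_le.
  (* If the left strand were a red [r], a black [b'] after it at the bottom would satisfy [r <= b'],
     but before it at the top [b' < r]; two reds never change their order. *)
  - by case=> [r|b] [r'|b'] //=; lia.
  - by rewrite -entry_seq_std; apply: hB.
have dblE lam (s t : TD lam) : dbl D s t = dbl B (val (std s)) (val (std t)).
  by rewrite /dbl !DB.
have cD lam (s t : TD lam) : corner (dbl D s t).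
  by rewrite dblE; apply: corner_dbl.
exists (fun lam => @std l n lam); split=> [||nu theta Phi iso].
- exact: std_bij.
- by move=> lam s t; split; [exact: cD | exact: dblE].
split=> [lam s t|le inv cB Pinv].
  by split; [case: (Phi_bij iso) => + _ _; apply; exact: cD | rewrite dblE].
have -> : (fun lam (s t : TD lam) => Phi (dbl D s t)) =
    (fun lam s t => Phi (dbl B (val (std s)) (val (std t)))).
  by do 3!apply: functional_extensionality_dep => ?; rewrite dblE.
apply: (cellular_transport (corner0 k l n) (@corner_linear k l n)
  (@corner_mul k l n) (Phi_linear iso) (Phi_mul iso) (Phi_bij iso) Pinv
  _ (@std_bij l n) (corner_cellular hB cB)).
exact: corner_dbl.
Qed.
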